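(* Let $K\subseteq\mathbb{R}^n$ be a convex body such that $b(K)\in tE_K$ for some $t\in[0,1)$. Then $\mathrm{vol}(K\cap-K)\ge\left(\frac{1-t}{2}\right)^n\mathrm{vol}(K)$.
   Context: $b(K)=\frac1{\mathrm{vol}(K)}\int_Kx\,dx$, $\mathrm{cov}(K)=\frac1{\mathrm{vol}(K)}\int_K(x-b(K))(x-b(K))^tdx$, and $E_K=\{x:x^t\mathrm{cov}(K)^{-1}x\le1\}$. *)

(* Defs.v *)
From HB Require Import structures.
From mathcomp Require Import all_boot all_order all_algebra.
From mathcomp Require Import all_classical all_reals all_analysis.

Set Implicit Arguments.
Unset Strict Implicit.
Unset Printing Implicit Defensive.
Import Order.TTheory GRing.Theory Num.Theory.
Import numFieldTopology.Exports numFieldNormedType.Exports.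

Local Open Scope classical_set_scope.
Local Open Scope ring_scope.

Definition measure_cV_display : measure_display -> measure_display.
Proof. exact. Qed.

(* R^n is the type 'cV[R]_n of column vectors, with the sigma-algebra generated
   by the n coordinate maps, which is the Borel sigma-algebra of R^n. *)
Section measurable_cV.
Context {R : realType} {n : nat}.

Definition cV_coord (i : 'I_n) (x : 'cV[R]_n) : measurableTypeR R := x i 0.

Let cV_set0 : g_sigma_preimage cV_coord set0.
Proof. exact: sigma_algebra0. Qed.

Let cV_setC A : g_sigma_preimage cV_coord A -> g_sigma_preimage cV_coord (~` A).
Proof. exact: sigma_algebraC. Qed.

Let cV_bigcup (F : _^nat) : (forall i, g_sigma_preimage cV_coord (F i)) ->
  g_sigma_preimage cV_coord (\bigcup_i (F i)).
Proof. exact: sigma_algebra_bigcup. Qed.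

HB.instance Definition _ := @isMeasurable.Build
  (measure_cV_display default_measure_display) 'cV[R]_n
  (g_sigma_preimage cV_coord) cV_set0 cV_setC cV_bigcup.

Lemma measurable_cV_coord (i : 'I_n) : measurable_fun [set: 'cV[R]_n] (cV_coord i).
Proof.
move=> _ Y mY; rewrite setTI; apply: sub_sigma_algebra => /=.
rewrite -bigcup_seq/=; exists i => /=; first by rewrite mem_index_enum.
by exists Y => //; rewrite setTI.
Qed.

Lemma measurable_fun_cV d (T : measurableType d) (f : T -> 'cV[R]_n) :
  (forall i, measurable_fun [set: T] (cV_coord i \o f)) ->
  measurable_fun [set: T] f.
Proof.
move=> mf _ A mA; rewrite setTI; move: A mA.
have : g_sigma_preimage (fun i => cV_coord i \o f) `<=` measurable.
  apply: smallest_sub; first exact: sigma_algebra_measurable.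
  rewrite -bigcup_seq; apply: bigcup_sub => i _ A [B mB <-]; exact: mf.
rewrite g_sigma_preimage_comp => H A mA; apply: H; exists A => //.
by rewrite setTI.
Qed.

End measurable_cV.

(* Lebesgue measure on R^n.+1 is the image of the product of the Lebesgue
   measures on R and R^n by the identification of R * R^n with R^n.+1. *)
Section lebesgue_measure_cons.
Context {R : realType} {n : nat}.

Definition cV_cons (p : measurableTypeR R * 'cV[R]_n) : 'cV[R]_n.+1 :=
  col_mx (p.1 : R)%:M p.2.

Definition cV_uncons (x : 'cV[R]_n.+1) : measurableTypeR R * 'cV[R]_n :=
  (x 0 0, dsubmx (x : 'cV[R]_(1 + n))).

Lemma cV_consK : cancel cV_cons cV_uncons.
Proof.
move=> [a x]; rewrite /cV_uncons /cV_cons/= col_mxKd; congr (_, _).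
transitivity (col_mx (a : R)%:M x (lshift n 0) 0).
  by congr (fun_of_matrix _ _ _); exact/val_inj.
by rewrite col_mxEu mxE eqxx.
Qed.

Lemma measurable_cV_cons : measurable_fun setT cV_cons.
Proof.
apply: measurable_fun_cV => i.
case: (split_ordP (i : 'I_(1 + n))) => j ->.
  rewrite [X in measurable_fun _ X](_ : _ = fst)//; apply/funext => -[a x].
  by apply: (etrans (col_mxEu (a : R)%:M x j 0)); rewrite mxE !ord1 eqxx.
rewrite [X in measurable_fun _ X](_ : _ = cV_coord j \o snd).
  exact: measurableT_comp (measurable_cV_coord j) measurable_snd.
by apply/funext => -[a x]; exact: (col_mxEd (a : R)%:M x j 0).
Qed.

Lemma measurable_cV_uncons : measurable_fun setT cV_uncons.
Proof.
apply/measurable_fun_pairP; split; first exact: (measurable_cV_coord 0).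
apply: measurable_fun_cV => i.
rewrite [X in measurable_fun _ X](_ : _ = cV_coord (rshift 1 i)).
  exact: measurable_cV_coord.
by apply/funext => x; rewrite /cV_coord/= mxE.
Qed.

Variable mu : {sigma_finite_measure set 'cV[R]_n -> \bar R}.

Definition lebesgue_measure_cons : set 'cV[R]_n.+1 -> \bar R :=
  pushforward (@lebesgue_measure R \x mu)%E cV_cons.


Let nu : {measure set 'cV[R]_n.+1 -> \bar R} :=
  measure_function_pushforward__canonical__measure_function_Measure
    (@lebesgue_measure R \x mu)%E measurable_cV_cons.

HB.instance Definition _ := isMeasure.Build _ _ _ lebesgue_measure_cons
  (measure0 nu) (measure_ge0 nu) (@measure_semi_sigma_additive _ _ _ nu).

Let lebesgue_measure_cons_sigma_finite :
  sigma_finite setT lebesgue_measure_cons.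
Proof.
have /sigma_finiteP[F [FT Fnd Foo]] := sigma_finiteT (@lebesgue_measure R).
have /sigma_finiteP[G [GT Gnd Goo]] := sigma_finiteT mu.
exists (fun k => cV_uncons @^-1` (F k `*` G k)).
  apply/esym; rewrite -subTset => x _.
  have [i _ Fi] : (\bigcup_i F i) (cV_uncons x).1 by rewrite -FT.
  have [j _ Gj] : (\bigcup_i G i) (cV_uncons x).2 by rewrite -GT.
  exists (maxn i j) => //; split.
  - by move: Fi; exact/subsetPset/Fnd/leq_maxl.
  - by move: Gj; exact/subsetPset/Gnd/leq_maxr.
move=> k; have [mF Fk] := Foo k; have [mG Gk] := Goo k; split.
  rewrite -[X in measurable X]setTI; apply: measurable_cV_uncons => //.
  exact: measurableX.
rewrite /lebesgue_measure_cons /pushforward -comp_preimage.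
rewrite (_ : _ \o _ = id); last by apply/funext => p; exact: cV_consK.
by rewrite preimage_id product_measure1E// lte_mul_pinfty// ge0_fin_numE.
Qed.

HB.instance Definition _ := Measure_isSigmaFinite.Build _ _ _
  lebesgue_measure_cons lebesgue_measure_cons_sigma_finite.

End lebesgue_measure_cons.

(* R^0 is a single point, of volume 1. *)
Fixpoint lebesgue_measure_cV (R : realType) (n : nat) :
    {sigma_finite_measure set 'cV[R]_n -> \bar R} :=
  match n with
  | 0 => [the {sigma_finite_measure set 'cV[R]_0 -> \bar R} of
           dirac (0 : 'cV[R]_0)]
  | n'.+1 => [the {sigma_finite_measure set 'cV[R]_n'.+1 -> \bar R} of
               lebesgue_measure_cons (lebesgue_measure_cV R n')]
  end.

Lemma lebesgue_measure_cV_box (R : realType) (n : nat) (a b : 'I_n -> R) :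
  (forall i, a i <= b i) ->
  lebesgue_measure_cV R n [set x | forall i, a i <= x i 0 <= b i] =
  (\prod_(i < n) (b i - a i))%:E.
Proof.
elim: n a b => [|n IHn] a b ab.
  by rewrite big_ord0 /= diracE mem_set// => -[].
rewrite big_ord_recl /= /lebesgue_measure_cons /pushforward.
pose B := [set x : 'cV[R]_n | forall i, a (lift ord0 i) <= x i 0 <= b (lift ord0 i)].
have mB : measurable B.
  rewrite (_ : B = \bigcap_(i in [set: 'I_n])
      (cV_coord i @^-1` `[a (lift ord0 i), b (lift ord0 i)])); last first.
    apply/seteqP; split => [x Bx i _|x Bx i]; first by rewrite /= in_itv/= Bx.
    by have := Bx i I; rewrite /= in_itv.
  apply: fin_bigcap_measurable; first exact: finite_finset.
  move=> i _; rewrite -[X in measurable X]setTI.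
  exact: (measurable_cV_coord i).
rewrite (_ : _ @^-1` _ = `[a ord0, b ord0] `*` B); last first.
  have lE (p : measurableTypeR R * 'cV[R]_n) i :
      cV_cons p (lift ord0 i) 0 = p.2 i 0.
    rewrite -(col_mxEd (p.1 : R)%:M p.2 i 0).
    by congr (fun_of_matrix _ _ _); exact/val_inj.
  have hE (p : measurableTypeR R * 'cV[R]_n) : cV_cons p ord0 0 = p.1.
    by rewrite -[RHS](congr1 fst (cV_consK p)).
  apply/seteqP; split => p /=.
    by move=> Hp; split => [|i]; [rewrite in_itv/= -hE|rewrite -lE].
  move=> [p1 p2] i; case: (unliftP ord0 i) => [j ->|->]; first by rewrite lE.
  by move: p1; rewrite in_itv/= hE.
rewrite product_measure1E//= IHn//= lebesgue_measure_itv/= lte_fin.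
have := ab ord0; rewrite le_eqVlt => /predU1P[->|->]; last by rewrite EFinM EFinB.
by rewrite ltxx subrr !mul0r mul0e.
Qed.

Section convex_body.
Context {R : realType} {n : nat}.
Implicit Type K : set 'cV[R]_n.

Definition convex_body K :=
  [/\ @convex_set R 'cV[R]_n K, compact K & K^° !=set0].

Definition vol K : \bar R := lebesgue_measure_cV R n K.

Definition barycenter K : 'cV[R]_n :=
  (fine (vol K))^-1 *:
  \col_i \int[lebesgue_measure_cV R n]_(x in K) x i 0.

Definition covariance_mx K : 'M[R]_n :=
  (fine (vol K))^-1 *:
  \matrix_(i, j) \int[lebesgue_measure_cV R n]_(x in K)
    (((x - barycenter K) *m (x - barycenter K)^T) i j).

(* x^T A x is a 1 x 1 matrix, hence the final coordinates [0 0]. *)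
Definition covariance_ellipsoid K : set 'cV[R]_n :=
  [set x | (x^T *m invmx (covariance_mx K) *m x) 0 0 <= 1].

End convex_body.

(* Main.v *)
Require Import Defs.
From mathcomp Require Import all_boot all_order all_algebra.
From mathcomp Require Import all_classical all_reals all_analysis.
From mathcomp Require Import measurable_realfun ring lra.
Import Order.TTheory GRing.Theory Num.Theory.
Import numFieldTopology.Exports numFieldNormedType.Exports.
Local Open Scope classical_set_scope.
Local Open Scope ring_scope.

(* Write b for the barycenter and E for the covariance ellipsoid of K. Both
   ingredients come from the midpoint Prekopa-Leindler inequality.

   Milman-Pajor: F m := vol (K `&` (2 m - K)) is log-concave, and b is its
   barycenter on K. Jensen's inequality for ln F with weight F gives
   ln (F b) >= (int F ln F) / (int F) >= ln ((int F) / vol K), and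
   int F = 2^-n (vol K)^2, so F b >= 2^-n vol K.

   b - E is contained in K: if an affine W >= 0 on K has mean m1, then W^2 has
   mean at most 2 m1^2, so the variance of a linear form on K is at most the square
   of the distance from its mean to its maximum; separate b - e from K.

   If b = t e with e in E, then y := b - e lies in K and (1 - t) b + t y = 0.
   Hence x |-> (1 - t) x + t y maps K `&` (2 b - K) into K `&` - K. *)

(** * Brunn-Minkowski and Prekopa-Leindler on the line *)

(** Why [F] has these integrals: [2^n F / (vol K)^2] is the density of the midpoint of two
    independent uniform points of [K]. So its mean is [b] and its total mass is known exactly. The
    final constant combines this [2^-n] with the factor [(1 - t)^n] of the contraction.

    The constant 2 in the bound on the mean of [W^2] is the ratio of the second moment to the
    squared mean of an exponential variable, the extremal log-concave law on a half-line. It leaves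
    exactly [m1^2] for the variance, which is why [E] fits with radius 1.

    The obstacle in Jensen's inequality is that [F] may vanish on [K], so that [ln F] is not bounded
    below, and that only midpoint log-concavity and upper semicontinuity of [F] are at hand. Instead
    of a supporting hyperplane at [b], the mean of the points [(x, ln F x)] is shown to be a limit
    of points of the hypograph.

    Working with midpoints only keeps real powers out: the Prekopa-Leindler hypothesis is a bound of
    a product by a square, and both applications need no other weight. *)

Lemma measurable_affine (R : realType) (a v : R) :
  measurable_fun [set: measurableTypeR R]
    (fun x : measurableTypeR R => a * x + v : measurableTypeR R).
Proof. by apply: measurable_funD => //; apply: measurable_funM. Qed.

(** Both sides are measures in [A], the right one a scaled push-forward, that agree on half-open
    intervals; uniqueness of Lebesgue measure does the rest. *)
Lemma lebesgue_measure_affine (R : realType) (a v : R) (A : set R) :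
  0 < a -> measurable A ->
  (@lebesgue_measure R A = a%:E * lebesgue_measure ((fun x : R => (a * x + v)%R) @^-1` A))%E.
Proof.
move=> a0 mA.
pose nu := measure_function_pushforward__canonical__measure_function_Measure
  (@lebesgue_measure R) (measurable_affine R a v).
have a0' : 0 <= a by exact: ltW.
rewrite (@lebesgue_measure_unique R (mscale (NngNum a0') nu))//.
move=> X [[u w] _ <-].
transitivity (a%:E * lebesgue_measure ((fun x => (a * x + v)%R) @^-1` `]u, w]%classic))%E => //.
rewrite (_ : _ @^-1` _ = `](u - v) / a, (w - v) / a]%classic); last first.
  by apply/seteqP; split => x /=; rewrite !in_itv/= ltr_pdivrMr// ler_pdivlMr//
    ltrBlDr lerBrDr mulrC.
rewrite !lebesgue_measure_itv/= !lte_fin ltr_pM2r ?invr_gt0// ltrD2r.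
case: ifPn => _; last by rewrite mule0.
by rewrite -!EFinB -EFinM; congr EFin; field; lra.
Qed.

Lemma measurable_preimage_affine (R : realType) (a v : R) (A : set R) :
  measurable A -> measurable ((fun x : R => a * x + v) @^-1` A : set R).
Proof.
by move=> mA; rewrite -[X in measurable X]setTI; apply: (measurable_affine R a v).
Qed.

(** Let [a] be the maximum of [A] and [b] the minimum of [B]. The translates [A + b] and [a + B]
    both lie in [C], the first to the left of [a + b] and the second to its right. *)
Lemma lebesgue_measure_addset_compact (R : realType) (A B C : set R) :
  A !=set0 -> B !=set0 -> compact A -> compact B -> measurable C ->
  (forall x y, A x -> B y -> C (x + y)) ->
  (@lebesgue_measure R A + lebesgue_measure B <= lebesgue_measure C)%E.
Proof.
move=> A0 B0 cA cB mC ABC.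
have [a Aa maxa] : exists2 a : R, A a & forall t, A t -> t <= a.
  have [a /[!inE] Aa maxa] := @compact_EVT_max R^o R id A A0 cA
    (continuous_subspaceT (fun=> cvg_id)).
  by exists a => // t At; apply: maxa; rewrite inE.
have [b Bb minb] : exists2 b : R, B b & forall t, B t -> b <= t.
  have [b /[!inE] Bb minb] := @compact_EVT_min R^o R id B B0 cB
    (continuous_subspaceT (fun=> cvg_id)).
  by exists b => // t Bt; apply: minb; rewrite inE.
have mA := compact_measurable cA; have mB := compact_measurable cB.
pose A1 : set R := (fun x : R => 1 * x + - b) @^-1` A.
pose B1 : set R := (fun x : R => 1 * x + - a) @^-1` B.
have mA1 : measurable A1 by exact: measurable_preimage_affine.
have mB1 : measurable B1 by exact: measurable_preimage_affine.
(* The translates share only the point [a + b], a null set, which is removed to make the union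
   disjoint. *)
pose D : set R := B1 `\` [set a + b].
have mD : measurable D by exact: measurableD.
rewrite (@lebesgue_measure_affine _ 1 (- b) A)// (@lebesgue_measure_affine _ 1 (- a) B)//.
rewrite !mul1e.
apply: (@le_trans _ _ (lebesgue_measure A1 + lebesgue_measure D)%E).
  rewrite leeD2l//.
  have : B1 `<=` D `|` [set a + b].
    by move=> x B1x; have [->|/eqP xab] := eqVneq x (a + b); [right|left].
  move=> /(le_measure (@lebesgue_measure R)).
  move=> /(_ (mem_set mB1) (mem_set (measurableU _ _ mD (measurable_set1 _)))).
  move=> /le_trans; apply.
  apply: (le_trans (measureU2 _ _ _)) => //.
  by rewrite [X in (_ + X)%E](lebesgue_measure_set1 (a + b)) adde0.
rewrite -measureU//.
  apply: le_measure; rewrite ?inE//; first exact: measurableU.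
  move=> x [A1x|[B1x _]].
    have -> : x = (1 * x + - b) + b by ring.
    exact: ABC.
  have -> : x = a + (1 * x + - a) by ring.
  exact: ABC.
rewrite -subset0 => x [A1x [B1x /eqP xab]].
have h1 := maxa _ A1x; have h2 := minb _ B1x.
by move/eqP: xab; apply; lra.
Qed.

(** Inner regularity reduces to compact subsets. The two suprema are taken one after the other by
    moving the other measure across the inequality, hence the separate case of infinite
    [lebesgue_measure C]. *)
Lemma lebesgue_measure_addset (R : realType) (A B C : set R) :
  A !=set0 -> B !=set0 -> measurable A -> measurable B -> measurable C ->
  (forall x y, A x -> B y -> C (x + y)) ->
  (@lebesgue_measure R A + lebesgue_measure B <= lebesgue_measure C)%E.
Proof.
move=> [a Aa] [b Bb] mA mB mC ABC.
have [->|Cfin] := eqVneq (lebesgue_measure C) +oo%E; first exact: leey.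
have Cfin' : lebesgue_measure C \is a fin_num.
  by rewrite ge0_fin_numE// ltey.
have key K1 K2 : compact K1 -> compact K2 -> K1 `<=` A -> K2 `<=` B ->
    (@lebesgue_measure R K1 + lebesgue_measure K2 <= lebesgue_measure C)%E.
  move=> c1 c2 s1 s2.
  have cU (K : set R) (x : R) : compact K -> compact (K `|` [set x]).
    by move=> cK; apply: compactU => //; exact: compact_set1.
  (* A compact subset may be empty; adjoining a fixed point of [A], respectively [B], makes the
     compact case applicable. *)
  apply: (@le_trans _ _ (lebesgue_measure (K1 `|` [set a]) +
                         lebesgue_measure (K2 `|` [set b]))%E).
    apply: leeD; apply: le_measure; rewrite ?inE;
      by [apply: compact_measurable; auto|left].
  apply: lebesgue_measure_addset_compact => //; [by exists a; right|
    by exists b; right|exact: cU|exact: cU|].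
  move=> x y [K1x|->] [K2y|->]; apply: ABC => //; by [exact: s1|exact: s2].
have fin2 K2 : compact K2 -> K2 `<=` B -> (@lebesgue_measure R K2) \is a fin_num.
  move=> c2 s2; rewrite ge0_fin_numE//.
  by apply: compact_finite_measure.
have leA K2 : compact K2 -> K2 `<=` B ->
    (@lebesgue_measure R A <= lebesgue_measure C - lebesgue_measure K2)%E.
  move=> c2 s2; rewrite (lebesgue_regularity_inner_sup mA).
  apply: ge_ereal_sup => _ [K1 [c1 s1] <-].
  by rewrite leeBrDr ?fin2//; exact: key.
have Afin : (@lebesgue_measure R A) \is a fin_num.
  rewrite ge0_fin_numE//; apply: le_lt_trans (leA set0 compact0 _) _; first exact: sub0set.
  by rewrite measure0 sube0 ltey.
rewrite addeC -leeBrDr//.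
rewrite (lebesgue_regularity_inner_sup mB).
apply: ge_ereal_sup => _ [K2 [c2 s2] <-].
by rewrite leeBrDr// addeC -leeBrDr ?fin2//; exact: leA.
Qed.

Lemma lebesgue_measure_midset (R : realType) (A B C : set R) :
  A !=set0 -> B !=set0 -> measurable A -> measurable B -> measurable C ->
  (forall x y, A x -> B y -> C (2^-1 * (x + y))) ->
  (@lebesgue_measure R A + lebesgue_measure B <= 2%:E * lebesgue_measure C)%E.
Proof.
move=> A0 B0 mA mB mC ABC.
pose C1 : set R := (fun x : R => 2^-1 * x + 0) @^-1` C.
have -> : (2%:E * lebesgue_measure C = lebesgue_measure C1)%E.
  rewrite (@lebesgue_measure_affine _ 2^-1 0 C)// ?invr_gt0//.
  by rewrite muleA -EFinM divff// mul1e.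
apply: lebesgue_measure_addset => //; first exact: measurable_preimage_affine.
by move=> x y Ax By; rewrite /C1/= addr0; exact: ABC.
Qed.

Lemma measurable_subgraph d (T : measurableType d) (R : realType) (f : T -> R) :
  measurable_fun setT f ->
  measurable [set p : T * measurableTypeR R | (0 <= p.2 < f p.1)%R].
Proof.
move=> mf.
rewrite [X in measurable X](_ : _ =
   (fun p : T * measurableTypeR R => (0 <= p.2)%R && (p.2 < f p.1)%R) @^-1` [set true]); last first.
  by apply/seteqP; split => p.
rewrite -[X in measurable X]setTI.
suff : measurable_fun setT
    (fun p : T * measurableTypeR R => (0 <= p.2)%R && (p.2 < f p.1)%R) by exact.
apply: measurable_and.
  by apply: measurable_fun_ler => //; exact: measurable_snd.
apply: measurable_fun_ltr; first exact: measurable_snd.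
by apply: measurableT_comp => //; exact: measurable_fst.
Qed.

Lemma ysection_subgraph (T : Type) (R : realType) (f : T -> R) (s : R) :
  ysection [set p : T * R | (0 <= p.2 < f p.1)%R] s = [set x | 0 <= s < f x].
Proof. by apply/seteqP; split => x; rewrite /ysection/= inE. Qed.

(** Tonelli for the indicator of the region under the graph. The clause [0 <= s] lets the height
    range over the whole line. *)
Lemma ge0_layer_cake d (T : measurableType d) (R : realType)
    (mu : {sigma_finite_measure set T -> \bar R}) (f : T -> R) :
  measurable_fun setT f -> (forall x, 0 <= f x) ->
  (\int[mu]_x (f x)%:E =
   \int[@lebesgue_measure R]_s mu [set x | (0 <= s < f x)%R])%E.
Proof.
move=> mf f0.
pose F (p : T * measurableTypeR R) : \bar R := (\1_[set p | (0 <= p.2 < f p.1)%R] p)%:E.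
have mS := measurable_subgraph _ _ _ _ mf.
have mF : measurable_fun setT F by apply/measurable_EFinP/measurable_indic.
have F0 p : (0 <= F p)%E by rewrite /F lee_fin.
transitivity (\int[mu]_x \int[@lebesgue_measure R]_s F (x, s))%E.
  apply: eq_integral => x _.
  rewrite (_ : (fun s => F (x, s)) = (fun s => (\1_(`[0%R, f x[%classic) s)%:E)); last first.
    by apply/funext => s; rewrite /F !indicE; congr (_%:R%:E).
  rewrite integral_indic//= setIT lebesgue_measure_itv/= lte_fin.
  case: ltgtP (f0 x) => //= [_ _|<- //].
  by rewrite sube0.
rewrite (fubini_tonelli F)//.
apply: eq_integral => s _.
rewrite (_ : (fun x => F (x, s)) = (fun x => (\1_[set x | (0 <= s < f x)%R] x)%:E)); last first.
  by apply/funext => x; rewrite /F !indicE; congr (_%:R%:E).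
rewrite integral_indic//= ?setIT//.
by rewrite -ysection_subgraph; exact: measurable_ysection.
Qed.

(** With both suprema equal to 1, the level sets of [f] and [g] at each height [0 <= s < 1] are
    nonempty and their midpoints lie in the level set of [h]; Brunn-Minkowski on the line is
    integrated over [s]. The additive conclusion is stronger than the product form, by AM-GM. *)
Lemma prekopa_leindler_line_normalised (R : realType) (f g h : measurableTypeR R -> R) :
  measurable_fun setT f -> measurable_fun setT g -> measurable_fun setT h ->
  (forall x, 0 <= f x <= 1) -> (forall x, 0 <= g x <= 1) -> (forall x, 0 <= h x) ->
  (forall s, s < 1 -> exists x, s < f x) ->
  (forall s, s < 1 -> exists x, s < g x) ->
  (forall x y, f x * g y <= h (2^-1 * (x + y)) ^+ 2) ->
  (\int[@lebesgue_measure R]_x (f x)%:E + \int[@lebesgue_measure R]_x (g x)%:E <=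
   2%:E * \int[@lebesgue_measure R]_x (h x)%:E)%E.
Proof.
move=> mf mg mh f01 g01 h0 fsup gsup fgh.
have mlev (k : measurableTypeR R -> R) s : measurable_fun setT k ->
    measurable [set x | (0 <= s < k x)%R].
  by move=> mk; rewrite -ysection_subgraph; apply: measurable_ysection; exact: measurable_subgraph.
have mmu (k : measurableTypeR R -> R) : measurable_fun setT k ->
    measurable_fun setT (fun s : measurableTypeR R =>
      @lebesgue_measure R [set x | (0 <= s < k x)%R]).
  move=> mk.
  have := measurable_fun_ysection (@lebesgue_measure R) (measurable_subgraph _ _ _ _ mk).
  by congr (measurable_fun _ _); apply/funext => s /=; rewrite ysection_subgraph.
have f0 x : 0 <= f x by have /andP[] := f01 x.
have g0 x : 0 <= g x by have /andP[] := g01 x.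
rewrite !ge0_layer_cake// -ge0_integralD//; last 2 first.
  exact: mmu.
  exact: mmu.
rewrite -ge0_integralZl_EFin//; last exact: mmu.
apply: ge0_le_integral => //.
- by move=> s _; exact: adde_ge0.
- by apply: emeasurable_funD; exact: mmu.
- by apply: measurable_funeM; exact: mmu.
move=> s _.
have empty (k : measurableTypeR R -> R) : (~~ (0 <= s < 1)) -> (forall x, 0 <= k x <= 1) ->
    [set x | 0 <= s < k x] = set0.
  move=> ns k01; rewrite -subset0 => x /= /andP[s0 sk].
  by move/negP: ns; apply; rewrite s0/= (lt_le_trans sk)//; have /andP[] := k01 x.
have [/andP[s0 s1]|ns] := boolP (0 <= s < 1); last first.
  by rewrite (empty f)// (empty g)// measure0 adde0 mule_ge0.
apply: lebesgue_measure_midset; [|  |exact: mlev|exact: mlev|exact: mlev|].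
- by have [x sx] := fsup s s1; exists x => /=; rewrite s0.
- by have [x sx] := gsup s s1; exists x => /=; rewrite s0.
move=> x y /= /andP[_ sx] /andP[_ sy]; rewrite s0/=.
rewrite -(ltr_pXn2r (n := 2))// ?nnegrE//.
apply: lt_le_trans (fgh x y).
by rewrite expr2 ltr_pM.
Qed.

(** Dividing [f], [g] and [h] by [al = sup f], [be = sup g] and [ga = sqrt (al * be)] preserves the
    midpoint hypothesis and normalises the suprema. AM-GM then turns the sum into a product. *)
Lemma prekopa_leindler_line_bounded (R : realType) (f g h : measurableTypeR R -> R) (M : R) :
  measurable_fun setT f -> measurable_fun setT g -> measurable_fun setT h ->
  (forall x, 0 <= f x <= M) -> (forall x, 0 <= g x <= M) -> (forall x, 0 <= h x) ->
  (forall x y, f x * g y <= h (2^-1 * (x + y)) ^+ 2) ->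
  ((\int[@lebesgue_measure R]_x (f x)%:E) * (\int[@lebesgue_measure R]_x (g x)%:E) <=
   (\int[@lebesgue_measure R]_x (h x)%:E) * (\int[@lebesgue_measure R]_x (h x)%:E))%E.
Proof.
move=> mf mg mh fM gM h0 fgh.
have f0 x : 0 <= f x by have /andP[] := fM x.
have g0 x : 0 <= g x by have /andP[] := gM x.
have supP (k : measurableTypeR R -> R) : (forall x, 0 <= k x <= M) ->
    exists2 a, (forall x, k x <= a) & forall s, s < a -> exists x, s < k x.
  move=> kM; have hs : has_sup (range k).
    split; first by exists (k 0), 0.
    by exists M => _ [x _ <-]; have /andP[] := kM x.
  exists (sup (range k)) => [x|s sa].
    by apply: ub_le_sup; [exact: hs.2|exists x].
  have : 0 < sup (range k) - s by rewrite subr_gt0.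
  move=> /(@sup_adherent _ (range k)) /(_ hs)[_ [x _ <-]].
  by rewrite opprB addrCA subrr addr0; exists x.
have [al fal fsup] := supP _ fM.
have [be gbe gsup] := supP _ gM.
have trivial_case (k : measurableTypeR R -> R) c : (forall x, 0 <= k x) -> (forall x, k x <= c) ->
    c <= 0 -> (\int[@lebesgue_measure R]_x (k x)%:E = 0)%E.
  move=> k0 kc c0; apply: integral0_eq => x _.
  by congr EFin; apply/le_anti; rewrite k0 (le_trans (kc x)).
have rhs0 : (0 <= (\int[@lebesgue_measure R]_x (h x)%:E) * (\int[@lebesgue_measure R]_x (h x)%:E))%E.
  by rewrite mule_ge0//; apply: integral_ge0 => x _; rewrite lee_fin.
have [al0|al0] := leP al 0; first by rewrite (trivial_case f al)// mul0e.
have [be0|be0] := leP be 0; first by rewrite (trivial_case g be)// mule0.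
pose ga := Num.sqrt (al * be).
have ga0 : 0 < ga by rewrite sqrtr_gt0 mulr_gt0.
have ga2 : ga ^+ 2 = al * be by rewrite sqr_sqrtr// mulr_ge0// ltW.
have scale (k : measurableTypeR R -> R) c : 0 < c -> (forall x, 0 <= k x) -> measurable_fun setT k ->
    (\int[@lebesgue_measure R]_x (k x)%:E = c%:E * \int[@lebesgue_measure R]_x (k x / c)%:E)%E.
  move=> c0 k0 mk; rewrite -ge0_integralZl_EFin//; last 3 first.
  - by move=> x _; rewrite lee_fin divr_ge0// ltW.
  - by apply/measurable_EFinP; apply: measurable_funM.
  - exact: ltW.
  by apply: eq_integral => x _; rewrite -EFinM mulrC divfK// gt_eqF.
have nrm (k : measurableTypeR R -> R) c : 0 < c -> (forall x, 0 <= k x) -> (forall x, k x <= c) ->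
    forall x, 0 <= k x / c <= 1.
  by move=> c0 k0 kc x; rewrite divr_ge0 ?(ltW c0)//= ler_pdivrMr// mul1r.
have nrs (k : measurableTypeR R -> R) c : 0 < c -> (forall s, s < c -> exists x, s < k x) ->
    forall s, s < 1 -> exists x, s < k x / c.
  move=> c0 kc s s1; have [|x sx] := kc (s * c); first by rewrite gtr_pMl.
  by exists x; rewrite ltr_pdivlMr.
have mdiv (k : measurableTypeR R -> R) c : measurable_fun setT k ->
  measurable_fun setT (fun x => k x / c) by move=> mk; apply: measurable_funM.
have main := @prekopa_leindler_line_normalised R (fun x => f x / al) (fun x => g x / be)
  (fun x => h x / ga) (mdiv _ _ mf) (mdiv _ _ mg) (mdiv _ _ mh) (nrm _ _ al0 f0 fal)
  (nrm _ _ be0 g0 gbe) (fun x => divr_ge0 (h0 x) (ltW ga0)) (nrs _ _ al0 fsup)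
  (nrs _ _ be0 gsup).
rewrite (scale f al)// (scale g be)// (scale h ga)//.
have {main} : (\int[@lebesgue_measure R]_x (f x / al)%:E + \int[@lebesgue_measure R]_x (g x / be)%:E <=
   2%:E * \int[@lebesgue_measure R]_x (h x / ga)%:E)%E.
  apply: main => x y; rewrite expr_div_n ga2 mulf_div.
  by rewrite ler_pM2r ?invr_gt0 ?mulr_gt0//; exact: fgh.
have int0 (k : measurableTypeR R -> R) c : 0 < c -> (forall x, 0 <= k x) ->
    (0 <= \int[@lebesgue_measure R]_x (k x / c)%:E)%E.
  by move=> c0 k0; apply: integral_ge0 => x _; rewrite lee_fin divr_ge0 ?(ltW c0).
move: (int0 f al al0 f0) (int0 g be be0 g0) (int0 h ga ga0 h0).
move: (integral _ _ _) (integral _ _ _) (integral _ _ _) => H G F F0 G0 H0 FGH.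
have [->|Hoo] := eqVneq H +oo%E.
  by rewrite gt0_muley ?lte_fin// mulyy leey.
have Hfin : H \is a fin_num by rewrite ge0_fin_numE// ltey.
have FGfin : (F + G < +oo)%E by apply: le_lt_trans FGH _; rewrite ltey_eq fin_numM.
have Ffin : F \is a fin_num.
  by rewrite ge0_fin_numE//; apply: le_lt_trans FGfin; exact: leeDl.
have Gfin : G \is a fin_num.
  by rewrite ge0_fin_numE//; apply: le_lt_trans FGfin; exact: leeDr.
move: F0 G0 H0 FGH; rewrite -(fineK Ffin) -(fineK Gfin) -(fineK Hfin).
rewrite -!EFinM -EFinD !lee_fin.
move: (fine F) (fine G) (fine H) => p q r p0 q0 r0 pqr.
have -> : al * p * (be * q) = ga ^+ 2 * (p * q) by rewrite ga2; ring.
have -> : ga * r * (ga * r) = ga ^+ 2 * (r * r) by ring.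
rewrite ler_pM2l ?exprn_gt0//.
have pq2 : (p + q) * (p + q) <= 2 * r * (2 * r) by rewrite ler_pM ?addr_ge0.
have := sqr_ge0 (p - q); nra.
Qed.

Lemma cvg_mine_natr (R : realType) (x : \bar R) :
  (mine x (N%:R)%:E) @[N --> \oo] --> x.
Proof.
have [->|xoo] := eqVneq x +oo%E.
  rewrite (_ : (fun N => _) = (fun N => (N%:R)%:E)); last first.
    by apply/funext => N; rewrite /mine ltNge leey.
  by apply/cvgeryP; exact: cvgr_idn.
apply: cvg_near_cst.
have [N xN] : exists N : nat, (x <= (N%:R)%:E)%E.
  case: x xoo => [r _|//|_]; last by exists 0%N; rewrite leNye.
  exists (Num.bound `|r|); rewrite lee_fin (le_trans (ler_norm _))// ltW//.
  exact: archi_boundP.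
exists N => // k /= Nk; rewrite /mine; case: ifPn => //; rewrite -leNgt => h.
apply/le_anti; rewrite h/= (le_trans xN)// lee_fin ler_nat//.
Qed.

Lemma cvg_integral_mine_natr d (T : measurableType d) (R : realType)
    (mu : {measure set T -> \bar R}) (f : T -> \bar R) :
  measurable_fun setT f -> (forall x, 0 <= f x)%E ->
  (\int[mu]_x mine (f x) (N%:R)%:E)%E @[N --> \oo] --> (\int[mu]_x f x)%E.
Proof.
move=> mf f0.
have -> : (\int[mu]_x f x = \int[mu]_x limn (fun N => mine (f x) (N%:R)%:E))%E.
  by apply: eq_integral => x _; apply/esym/cvg_lim => //; exact: cvg_mine_natr.
apply: cvg_monotone_convergence => //.
- by move=> N; apply: measurable_mine => //; exact: measurable_cst.
- by move=> N x _; rewrite le_min f0/= lee_fin.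
- move=> x _ m k mk; rewrite le_min !ge_min lexx/= lee_fin ler_nat mk.
  by rewrite orbT.
Qed.

(** Infinite values are allowed because marginals in the induction on the dimension can be infinite.
    Truncation at height [N] and monotone convergence reduce to the bounded case. *)
Lemma prekopa_leindler_line (R : realType) (f g h : measurableTypeR R -> \bar R) :
  measurable_fun setT f -> measurable_fun setT g -> measurable_fun setT h ->
  (forall x, 0 <= f x)%E -> (forall x, 0 <= g x)%E -> (forall x, 0 <= h x)%E ->
  (forall x y, f x * g y <= h (2^-1 * (x + y))%R * h (2^-1 * (x + y))%R)%E ->
  ((\int[@lebesgue_measure R]_x f x) * (\int[@lebesgue_measure R]_x g x) <=
   (\int[@lebesgue_measure R]_x h x) * (\int[@lebesgue_measure R]_x h x))%E.
Proof.
move=> mf mg mh f0 g0 h0 fgh.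
pose tr (k : measurableTypeR R -> \bar R) (N : nat) x : R := fine (mine (k x) (N%:R)%:E).
have trE (k : measurableTypeR R -> \bar R) N : (forall x, 0 <= k x)%E ->
    forall x, (tr k N x)%:E = mine (k x) (N%:R)%:E.
  move=> k0 x; rewrite /tr fineK// ge0_fin_numE ?le_min ?k0 ?lee_fin ?ler0n//.
  by rewrite gt_min ltry orbT.
have mtr (k : measurableTypeR R -> \bar R) N : measurable_fun setT k ->
    measurable_fun setT (tr k N).
  move=> mk; apply: measurableT_comp => //.
  by apply: measurable_mine => //; exact: measurable_cst.
have tr0 (k : measurableTypeR R -> \bar R) N : (forall x, 0 <= k x)%E ->
    forall x, 0 <= tr k N x <= N%:R.
  move=> k0 x; rewrite -!lee_fin trE// le_min k0 lee_fin ler0n/=.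
  by rewrite ge_min lexx orbT.
have intle (k : measurableTypeR R -> \bar R) N : measurable_fun setT k -> (forall x, 0 <= k x)%E ->
    (\int[@lebesgue_measure R]_x (tr k N x)%:E <= \int[@lebesgue_measure R]_x k x)%E.
  move=> mk k0; apply: ge0_le_integral => //.
  - by move=> x _; rewrite lee_fin; have /andP[] := tr0 k N k0 x.
  - by apply/measurable_EFinP; exact: mtr.
  - by move=> x _; rewrite trE// ge_min lexx.
have int0 (k : measurableTypeR R -> \bar R) N : (forall x, 0 <= k x)%E ->
    (0 <= \int[@lebesgue_measure R]_x (tr k N x)%:E)%E.
  by move=> k0; apply: integral_ge0 => x _; rewrite lee_fin; have /andP[] := tr0 k N k0 x.
have main N : ((\int[@lebesgue_measure R]_x (tr f N x)%:E) * (\int[@lebesgue_measure R]_x (tr g N x)%:E) <=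
   (\int[@lebesgue_measure R]_x h x) * (\int[@lebesgue_measure R]_x h x))%E.
  apply: (@le_trans _ _ ((\int[@lebesgue_measure R]_x (tr h N x)%:E) * (\int[@lebesgue_measure R]_x (tr h N x)%:E))%E).
    apply: (@prekopa_leindler_line_bounded _ _ _ _ N%:R); [exact: mtr|exact: mtr|exact: mtr|exact: tr0|exact: tr0| |].
      by move=> x; have /andP[] := tr0 h N h0 x.
    move=> x y; set z := 2^-1 * (x + y).
    have /andP[fx0 fxN] := tr0 f N f0 x; have /andP[gy0 gyN] := tr0 g N g0 y.
    (* Truncation keeps the midpoint hypothesis: either [h z] is unchanged, or it is cut to [N],
       which dominates the cut values of [f] and [g]. *)
    have [hN|hN] := leP (h z) (N%:R)%:E.
      rewrite -lee_fin expr2 !EFinM !trE//.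
      rewrite (_ : mine (h z) _ = h z); last by rewrite /mine; case: ltgtP hN.
      apply: le_trans (fgh x y); apply: lee_pmul; rewrite ?ge_min ?lexx//.
        by rewrite le_min f0 lee_fin ler0n.
      by rewrite le_min g0 lee_fin ler0n.
    have -> : tr h N z = N%:R by rewrite /tr /mine ltNge (ltW hN).
    by rewrite expr2 ler_pM.
  by apply: lee_pmul; rewrite ?int0 ?intle.
(* Zero integrals are treated apart, so that the product of the limits is never of the form
   [0 * +oo]. *)
have [F0|F0] := eqVneq (\int[@lebesgue_measure R]_x f x)%E 0%E.
  by rewrite F0 mul0e mule_ge0// integral_ge0.
have [G0|G0] := eqVneq (\int[@lebesgue_measure R]_x g x)%E 0%E.
  by rewrite G0 mule0 mule_ge0// integral_ge0.
have FG : ((\int[@lebesgue_measure R]_x f x) *? (\int[@lebesgue_measure R]_x g x))%E.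
  by rewrite mule_defE (negbTE F0) (negbTE G0).
have cv := @cvgeM nat \oo _ R _ _ _ _ FG (cvg_integral_mine_natr _ _ _ (@lebesgue_measure R) f mf f0)
  (cvg_integral_mine_natr _ _ _ (@lebesgue_measure R) g mg g0).
apply: (cvge_le _ (cv _)); apply: nearW => N.
apply: le_trans (main N); rewrite le_eqVlt; apply/orP; left; apply/eqP.
by congr (_ * _)%E; apply: eq_integral => x _; rewrite trE.
Qed.

(** * Prekopa-Leindler and affine changes of variables in R^n *)

Lemma ge0_integral_lebesgue_measure_cV_cons (R : realType) (n : nat)
    (f : 'cV[R]_n.+1 -> \bar R) :
  measurable_fun setT f -> (forall x, 0 <= f x)%E ->
  (\int[lebesgue_measure_cV R n.+1]_x f x =
   \int[@lebesgue_measure R]_s \int[lebesgue_measure_cV R n]_x f (cV_cons (s, x)))%E.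
Proof.
move=> mf f0.
transitivity (\int[(@lebesgue_measure R \x lebesgue_measure_cV R n)%E]_p (f \o cV_cons) p)%E.
  have := ge0_integral_pushforward measurable_cV_cons
    (@lebesgue_measure R \x lebesgue_measure_cV R n)%E measurableT mf (fun x _ => f0 x).
  by rewrite preimage_setT => <-.
rewrite fubini_tonelli1//=.
by apply: measurableT_comp => //; exact: measurable_cV_cons.
Qed.

Lemma cV_cons0 (R : realType) (n : nat) (p : measurableTypeR R * 'cV[R]_n) :
  cV_cons p ord0 0 = p.1.
Proof. by rewrite -[RHS](congr1 fst (cV_consK p)). Qed.

Lemma cV_consS (R : realType) (n : nat) (p : measurableTypeR R * 'cV[R]_n) i :
  cV_cons p (lift ord0 i) 0 = p.2 i 0.
Proof.
rewrite -(col_mxEd (p.1 : R)%:M p.2 i 0).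
by congr (fun_of_matrix _ _ _); exact/val_inj.
Qed.

Lemma cV_unconsS (R : realType) (n : nat) (x : 'cV[R]_n.+1) i :
  (cV_uncons x).2 i 0 = x (lift ord0 i) 0.
Proof. by rewrite mxE; congr (x _ _); apply/val_inj. Qed.

Lemma cV_cons_mid (R : realType) (n : nat) (c s t : R) (x y : 'cV[R]_n) :
  cV_cons ((c * (s + t) : measurableTypeR R), c *: (x + y)) =
  c *: (cV_cons ((s : measurableTypeR R), x) + cV_cons ((t : measurableTypeR R), y)) :> 'cV[R]_n.+1.
Proof.
apply/matrixP => i j; rewrite ord1 [RHS]mxE [X in _ = _ * X]mxE.
by case: (unliftP ord0 i) => [k ->|->]; rewrite ?cV_consS ?cV_cons0//= !mxE.
Qed.

Lemma measurable_fun_marginal (R : realType) (n : nat) (f : 'cV[R]_n.+1 -> \bar R) :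
  measurable_fun setT f -> (forall x, 0 <= f x)%E ->
  measurable_fun setT (fun s : measurableTypeR R =>
    \int[lebesgue_measure_cV R n]_x f (cV_cons (s, x)))%E.
Proof.
move=> mf f0.
apply: (measurable_fun_fubini_tonelli_F (m2 := lebesgue_measure_cV R n) (f \o cV_cons)).
  by apply: measurableT_comp => //; exact: measurable_cV_cons.
by move=> p; exact: f0.
Qed.

Lemma measurable_fun_section (R : realType) (n : nat) (f : 'cV[R]_n.+1 -> \bar R)
    (s : measurableTypeR R) :
  measurable_fun setT f -> measurable_fun setT (fun x : 'cV[R]_n => f (cV_cons (s, x))).
Proof.
move=> mf; apply: measurableT_comp => //.
apply: measurableT_comp; first exact: measurable_cV_cons.
exact: pair1_measurable.
Qed.

(** Induction on the dimension: with first coordinates frozen at [s], [t] and their midpoint, the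
    sections satisfy the same hypothesis, so by induction the marginals satisfy it on the line. *)
Lemma prekopa_leindler (R : realType) (n : nat) (f g h : 'cV[R]_n -> \bar R) :
  measurable_fun setT f -> measurable_fun setT g -> measurable_fun setT h ->
  (forall x, 0 <= f x)%E -> (forall x, 0 <= g x)%E -> (forall x, 0 <= h x)%E ->
  (forall x y, f x * g y <= h (2^-1 *: (x + y))%R * h (2^-1 *: (x + y))%R)%E ->
  ((\int[lebesgue_measure_cV R n]_x f x) * (\int[lebesgue_measure_cV R n]_x g x) <=
   (\int[lebesgue_measure_cV R n]_x h x) * (\int[lebesgue_measure_cV R n]_x h x))%E.
Proof.
elim: n f g h => [|n IHn] f g h mf mg mh f0 g0 h0 fgh.
  rewrite !integral_dirac// !diracT !mul1e.
  by have := fgh 0 0; rewrite addr0 scaler0.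
rewrite (ge0_integral_lebesgue_measure_cV_cons _ _ _ mf f0).
rewrite (ge0_integral_lebesgue_measure_cV_cons _ _ _ mg g0).
rewrite (ge0_integral_lebesgue_measure_cV_cons _ _ _ mh h0).
apply: prekopa_leindler_line.
- exact: measurable_fun_marginal.
- exact: measurable_fun_marginal.
- exact: measurable_fun_marginal.
- by move=> s; exact: integral_ge0.
- by move=> s; exact: integral_ge0.
- by move=> s; exact: integral_ge0.
move=> s t; apply: IHn => //.
- exact: measurable_fun_section.
- exact: measurable_fun_section.
- exact: measurable_fun_section.
move=> x y; rewrite cV_cons_mid; exact: fgh.
Qed.

Lemma measurable_cV_affine (R : realType) (n : nat) (a : R) (v : 'cV[R]_n) :
  measurable_fun setT (fun x : 'cV[R]_n => a *: x + v).
Proof.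
apply: measurable_fun_cV => i.
rewrite (_ : _ \o _ = (fun x => a * x + v i 0) \o cV_coord i).
  by apply: measurableT_comp; [exact: measurable_affine|exact: measurable_cV_coord].
by apply/funext => x; rewrite /cV_coord/= !mxE.
Qed.

Lemma ge0_integral_line_affine (R : realType) (a v : R) (f : measurableTypeR R -> \bar R) :
  0 < a -> measurable_fun setT f -> (forall x, 0 <= f x)%E ->
  (\int[@lebesgue_measure R]_x f x =
   a%:E * \int[@lebesgue_measure R]_x f (a * x + v)%R)%E.
Proof.
move=> a0 mf f0.
pose nu := measure_function_pushforward__canonical__measure_function_Measure
  (@lebesgue_measure R) (measurable_affine R a v).
transitivity (\int[mscale (NngNum (ltW a0)) nu]_x f x)%E.
  apply: eq_measure_integral => A mA _.
  exact: lebesgue_measure_affine.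
rewrite ge0_integral_mscale//; congr (_ * _)%E.
rewrite ge0_integral_pushforward//.
exact: measurable_affine.
Qed.

Lemma cV_cons_affine (R : realType) (n : nat) (a s : R) (x : 'cV[R]_n) (v : 'cV[R]_n.+1) :
  a *: cV_cons ((s : measurableTypeR R), x) + v =
  cV_cons ((a * s + (cV_uncons v).1 : measurableTypeR R), a *: x + (cV_uncons v).2).
Proof.
apply/matrixP => i j; rewrite ord1 [LHS]mxE [X in X + _]mxE.
case: (unliftP ord0 i) => [k ->|->]; rewrite ?cV_consS ?cV_cons0//=.
by rewrite -cV_unconsS !mxE.
Qed.

Lemma ge0_integral_cV_affine (R : realType) (n : nat) (a : R) (v : 'cV[R]_n)
    (f : 'cV[R]_n -> \bar R) :
  0 < a -> measurable_fun setT f -> (forall x, 0 <= f x)%E ->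
  (\int[lebesgue_measure_cV R n]_x f x =
   (a ^+ n)%:E * \int[lebesgue_measure_cV R n]_x f (a *: x + v)%R)%E.
Proof.
move=> a0; elim: n v f => [|n IHn] v f mf f0.
  rewrite !integral_dirac// ?diracT ?expr0 ?mul1e; last first.
    by apply: measurableT_comp => //; exact: measurable_cV_affine.
  by congr f; apply/matrixP => -[].
have mfa : measurable_fun setT (fun x : 'cV[R]_n.+1 => f (a *: x + v)).
  by apply: measurableT_comp => //; exact: measurable_cV_affine.
rewrite (ge0_integral_lebesgue_measure_cV_cons _ _ _ mf f0).
rewrite (ge0_integral_lebesgue_measure_cV_cons _ _ _ mfa (fun x => f0 _)).
pose F (s : measurableTypeR R) := (\int[lebesgue_measure_cV R n]_x f (cV_cons (s, x)))%E.
have mF : measurable_fun setT F by exact: measurable_fun_marginal.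
have F0 s : (0 <= F s)%E by exact: integral_ge0.
rewrite (ge0_integral_line_affine _ a (cV_uncons v).1 F a0 mF F0) /F.
rewrite exprS EFinM -muleA; congr (_ * _)%E.
rewrite -ge0_integralZl_EFin//.
- apply: eq_integral => s _.
  rewrite (IHn (cV_uncons v).2)//; last exact: measurable_fun_section.
  by congr (_ * _)%E; apply: eq_integral => x _; rewrite cV_cons_affine.
- by move=> s _; exact: integral_ge0.
- exact: (measurable_fun_marginal _ _ (fun x => f (a *: x + v))).
- by rewrite exprn_ge0 ?ltW.
Qed.

Lemma lebesgue_measure_cV_affine (R : realType) (n : nat) (a : R) (v : 'cV[R]_n)
    (A : set 'cV[R]_n) :
  0 < a -> measurable A ->
  (lebesgue_measure_cV R n A =
   (a ^+ n)%:E * lebesgue_measure_cV R n ((fun x => (a *: x + v)%R) @^-1` A))%E.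
Proof.
move=> a0 mA.
have mA' : measurable ((fun x => (a *: x + v)%R) @^-1` A).
  by rewrite -[X in measurable X]setTI; apply: measurable_cV_affine.
rewrite -[A in LHS]setIT -integral_indic// (ge0_integral_cV_affine _ _ a v)//; last first.
  by apply: measurableT_comp => //; exact: measurable_indic.
by rewrite -[X in (_ * lebesgue_measure_cV R n X)%E]setIT -integral_indic.
Qed.

(** * Midpoint-convex sets and separation *)

(** The norm carried by ['cV[R]_n] is the maximum norm, so the Euclidean structure is set up
    separately. *)
Definition dot {R : realType} {n : nat} (x y : 'cV[R]_n) : R := \sum_i x i 0 * y i 0.

Definition sqn {R : realType} {n : nat} (x : 'cV[R]_n) : R := \sum_i x i 0 ^+ 2.

(** This is what [prekopa_leindler] can exploit, and all that will be known of the hypograph of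
    [ln F]. *)
Definition midconvex {R : realType} {n : nat} (C : set 'cV[R]_n) : Prop :=
  forall x y, C x -> C y -> C (2^-1 *: (x + y)).

Lemma dotDr (R : realType) (n : nat) (x y z : 'cV[R]_n) : dot x (y + z) = dot x y + dot x z.
Proof. by rewrite /dot -big_split/=; apply: eq_bigr => i _; rewrite mxE mulrDr. Qed.

Lemma dotZr (R : realType) (n : nat) (a : R) (x y : 'cV[R]_n) : dot x (a *: y) = a * dot x y.
Proof. by rewrite /dot mulr_sumr; apply: eq_bigr => i _; rewrite mxE mulrCA. Qed.

Lemma dotBr (R : realType) (n : nat) (x y z : 'cV[R]_n) : dot x (y - z) = dot x y - dot x z.
Proof. by rewrite -scaleN1r dotDr dotZr mulN1r. Qed.

Lemma dot0l (R : realType) (n : nat) (x : 'cV[R]_n) : dot 0 x = 0.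
Proof. by rewrite /dot big1// => i _; rewrite mxE mul0r. Qed.

Lemma dotZl (R : realType) (n : nat) (a : R) (x y : 'cV[R]_n) : dot (a *: x) y = a * dot x y.
Proof. by rewrite /dot mulr_sumr; apply: eq_bigr => i _; rewrite mxE mulrA. Qed.

Lemma dotBl (R : realType) (n : nat) (x y z : 'cV[R]_n) : dot (x - y) z = dot x z - dot y z.
Proof. by rewrite /dot -sumrB; apply: eq_bigr => i _; rewrite !mxE mulrBl. Qed.

Lemma dotxx (R : realType) (n : nat) (x : 'cV[R]_n) : dot x x = sqn x.
Proof. by apply: eq_bigr => i _; rewrite expr2. Qed.

Lemma sqn_ge0 (R : realType) (n : nat) (x : 'cV[R]_n) : 0 <= sqn x.
Proof. by apply: sumr_ge0 => i _; exact: sqr_ge0. Qed.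

Lemma le_sqn (R : realType) (n : nat) (x : 'cV[R]_n) i : x i 0 ^+ 2 <= sqn x.
Proof.
by rewrite /sqn (bigD1 i)//= lerDl; apply: sumr_ge0 => j _; exact: sqr_ge0.
Qed.

Lemma sqnBZ (R : realType) (n : nat) (s : R) (x y : 'cV[R]_n) :
  sqn (x - s *: y) = sqn x - 2 * s * dot x y + s ^+ 2 * sqn y.
Proof.
rewrite /sqn /dot !mulr_sumr -sumrB -big_split/=.
by apply: eq_bigr => i _; rewrite !mxE; ring.
Qed.

Lemma midconvex_dyadic (R : realType) (n : nat) (C : set 'cV[R]_n) (p x : 'cV[R]_n) (k : nat) :
  midconvex C -> C p -> C x -> C (p + 2^-1 ^+ k *: (x - p)).
Proof.
move=> mC Cp Cx; elim: k => [|k IHk]; first by rewrite expr0 scale1r addrC subrK.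
suff -> : p + 2^-1 ^+ k.+1 *: (x - p) = 2^-1 *: (p + (p + 2^-1 ^+ k *: (x - p))).
  exact: mC.
by apply/matrixP => i j; rewrite !mxE exprS; field.
Qed.

(* Compactness is avoided: an almost nearest point suffices. *)
Lemma midconvex_near_proj (R : realType) (n : nat) (C : set 'cV[R]_n) (q : 'cV[R]_n)
    (k : nat) (e : R) :
  C !=set0 -> midconvex C -> 0 < e ->
  exists2 p, C p & forall x, C x ->
    sqn (q - p) <= e + sqn (q - p - 2^-1 ^+ k *: (x - p)).
Proof.
move=> [c Cc] mC e0.
pose S := [set sqn (q - x) | x in C].
have infS : has_inf S.
  split; first by exists (sqn (q - c)), c.
  by exists 0 => _ [x _ <-]; exact: sqn_ge0.
have [_ [p Cp <-] pe] := inf_adherent e0 infS.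
exists p => // x Cx; apply: (le_trans (ltW pe)); rewrite addrC lerD2l.
rewrite -addrA -opprD; apply: inf_lbound; first exact: infS.2.
by exists (p + 2^-1 ^+ k *: (x - p)) => //; exact: midconvex_dyadic.
Qed.

Lemma compact_coord_bound (R : realType) (n : nat) (K : set 'cV[R]_n) :
  compact K -> exists2 M, 0 < M & forall x i, K x -> `|x i 0| <= M.
Proof.
move=> /compact_bounded[M [_ KM]].
have M1 : M < `|M| + 1 by rewrite (le_lt_trans (ler_norm _))// ltrDl.
exists (`|M| + 1) => [|x i Kx]; first by rewrite ltr_wpDl.
apply: le_trans (KM _ M1 x Kx).
by rewrite [leRHS]/Num.norm/= mx_normrE; apply: (le_bigmax _ (fun ij => `|x ij.1 ij.2|) (i, 0)).
Qed.

Lemma exp_half_small (R : realType) (e : R) : 0 < e -> exists k : nat, 2^-1 ^+ k < e.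
Proof.
move=> e0.
exists (Num.bound e^-1).
have h := @archi_boundP R e^-1 (ltW _); move: h; rewrite invr_gt0 => /(_ e0) h.
rewrite exprVn invf_plt ?posrE ?exprn_gt0//.
apply: lt_trans h _; rewrite -natrX ltr_nat.
exact: ltn_expl.
Qed.

Lemma closed_sqn_dist (R : realType) (n : nat) (K : set 'cV[R]_n) (y : 'cV[R]_n) :
  closed K -> ~ K y -> exists2 d, 0 < d & forall x, K x -> d <= sqn (y - x).
Proof.
move=> cK nKy.
have : nbhs y (~` K) by apply: open_nbhs_nbhs; split => //; exact: closed_openC.
move=> /nbhs_ballP[e /= e0 eK].
exists (e ^+ 2) => [|x Kx]; first by rewrite exprn_gt0.
rewrite leNgt; apply/negP => lt_e; apply: (eK x) => //.
rewrite /ball/= /mx_ball; split => // i j; rewrite /ball/= ord1.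
rewrite -(ltr_pXn2r (n := 2))// ?nnegrE ?normr_ge0 ?(ltW e0)//.
rewrite real_normK ?num_real//.
by apply: le_lt_trans lt_e; have := le_sqn R n (y - x) i; rewrite !mxE.
Qed.

(** An almost nearest point [p] of [K] to [y] gives the normal [u = y - p]: a short step from [p]
    towards [x] cannot shorten the distance to [y] by more than the tolerance, so
    [dot u (x - p) <= d / 2], whereas [dot u (y - p) >= d]. *)
Lemma compact_separation (R : realType) (n : nat) (K : set 'cV[R]_n) (y : 'cV[R]_n) :
  K !=set0 -> midconvex K -> compact K -> ~ K y ->
  exists u : 'cV[R]_n, exists2 e, 0 < e & forall x, K x -> dot u x + e <= dot u y.
Proof.
move=> K0 mK cK nKy.
have [d d0 dK] := closed_sqn_dist _ _ _ _ (compact_closed (@norm_hausdorff _ _) cK) nKy.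
have [M M0 KM] := compact_coord_bound _ _ _ cK.
(* A bound on squared distances within [K]; the 1 keeps it positive in dimension 0. *)
pose D : R := \sum_(i < n) (2 * M) ^+ 2 + 1.
have D0 : 0 < D by rewrite ltr_wpDl// sumr_ge0// => i _; exact: sqr_ge0.
have KD x p : K x -> K p -> sqn (x - p) <= D.
  move=> Kx Kp; rewrite /D (@le_trans _ _ (\sum_(i < n) (2 * M) ^+ 2))//; last by rewrite lerDl.
  apply: ler_sum => i _; rewrite -(real_normK (num_real ((x - p) i 0))).
  rewrite ler_pXn2r// ?nnegrE ?mulr_ge0 ?(ltW M0)//.
  rewrite !mxE (le_trans (ler_normB _ _))// mulr_natl mulr2n.
  by apply: lerD; exact: KM.
(* After division by [s], the tolerance [s * d / 2] and the quadratic term [s ^+ 2 * D] each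
   contribute at most [d / 2]. *)
have [k kd] : exists k : nat, 2^-1 ^+ k < d / (2 * D).
  by apply: exp_half_small; rewrite divr_gt0// mulr_gt0.
set s := 2^-1 ^+ k in kd.
have s0 : 0 < s by rewrite exprn_gt0.
have [|p Kp near_p] := midconvex_near_proj _ _ K y k (s * d / 2) K0 mK.
  by rewrite divr_gt0// mulr_gt0.
exists (y - p), (d / 2) => [|x Kx]; first by rewrite divr_gt0.
have := near_p x Kx; rewrite sqnBZ -/s.
have h1 := KD x p Kx Kp; have h2 := dK p Kp.
have -> : dot (y - p) x = dot (y - p) (x - p) + dot (y - p) p by rewrite -dotDr subrK.
have -> : dot (y - p) y = sqn (y - p) + dot (y - p) p.
  by rewrite -dotxx -dotDr subrK.
move: (dot _ (x - p)) (sqn (y - p)) h2 => v w h2 h3.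
have h4 : s * D <= d / 2.
  by move: kd; rewrite ltr_pdivlMr ?mulr_gt0// => kd; lra.
have h5 : 2 * s * v <= s * d / 2 + s * (s * sqn (x - p)) by lra.
have h6 : s * sqn (x - p) <= d / 2 by apply: le_trans h4; rewrite ler_pM2l.
have h7 : s * (s * sqn (x - p)) <= s * (d / 2) by rewrite ler_pM2l.
have h8 : s * v <= s * (d / 2) by lra.
rewrite ler_pM2l// in h8; lra.
Qed.

(** The sigma-algebra is generated by the coordinates, and an open set is the countable union of the
    boxes with rational centre and half-width [1 / (k + 1)] that it contains. *)
Lemma measurable_open_cV (R : realType) (n : nat) (U : set 'cV[R]_n) :
  open U -> measurable U.
Proof.
move=> oU.
pose box (p : 'cV[rat]_n * nat) : set 'cV[R]_n :=
  [set x | forall i, `|x i 0 - ratr (p.1 i 0)| < p.2.+1%:R^-1].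
have mbox p : measurable (box p).
  rewrite (_ : box p = \bigcap_(i in [set: 'I_n])
      (cV_coord i @^-1` (ball (ratr (p.1 i 0) : R) p.2.+1%:R^-1))); last first.
    apply/seteqP; split => [x Bx i _|x Bx i].
      by rewrite /ball/= distrC; exact: Bx.
    by have := Bx i I; rewrite /ball/= distrC.
  apply: fin_bigcap_measurable; first exact: finite_finset.
  move=> i _; rewrite -[X in measurable X]setTI.
  by apply: (measurable_cV_coord i) => //; exact: measurable_ball.
pose F p := if `[< box p `<=` U >] then box p else set0.
rewrite (_ : U = \bigcup_p F p).
  apply: countable_bigcupT_measurable; first exact: countableP.
  by move=> p; rewrite /F; case: asboolP => _; [exact: mbox|exact: measurable0].
apply/seteqP; split => [x Ux|x [p _]]; last by rewrite /F; case: asboolP => // pU; exact: pU.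
have /nbhs_ballP[e /= e0 eU] : nbhs x U by exact: open_nbhs_nbhs.
(* Half of [e], since [x] and any other point of the box are each that close to its centre. *)
have [N eN] : exists N : nat, N.+1%:R^-1 < e / 2.
  exists (Num.bound (e / 2)^-1).
  have h := @archi_boundP R (e / 2)^-1 (ltW _); move: h; rewrite invr_gt0 divr_gt0// => /(_ isT) h.
  rewrite invf_plt ?posrE ?divr_gt0//; apply: lt_trans h _.
  by rewrite ltr_nat.
have /choice[r rP] : forall i : 'I_n, exists q : rat, `|x i 0 - ratr q| < N.+1%:R^-1.
  move=> i.
  have [|q] := @rat_in_itvoo R (x i 0 - N.+1%:R^-1) (x i 0 + N.+1%:R^-1).
    by rewrite ltrD2l gtrN// invr_gt0.
  by rewrite in_itv/= => q12; exists q; rewrite distrC ltr_distl.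
have bx : box (\col_i r i, N) x by move=> i; rewrite /= mxE.
exists (\col_i r i, N) => //; rewrite /F; case: asboolP => // nsub; exfalso; apply: nsub.
move=> y yb; apply: eU; split => // i j; rewrite ord1 /ball/=.
have h1 := bx i; have h2 := yb i; move: h1 h2; rewrite /= mxE => h1 h2.
rewrite (le_lt_trans (ler_distD (ratr (r i)) _ _))//.
by rewrite [X in X + _]distrC [X in _ + X]distrC [ltRHS](splitr e) distrC ltrD ?(lt_trans _ eN)// distrC.
Qed.

Lemma measurable_closed_cV (R : realType) (n : nat) (A : set 'cV[R]_n) :
  closed A -> measurable A.
Proof.
by move=> cA; rewrite -(setCK A); apply: measurableC; apply: measurable_open_cV; exact: closed_openC.
Qed.

Lemma measurable_compact_cV (R : realType) (n : nat) (A : set 'cV[R]_n) :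
  compact A -> measurable A.
Proof.
by move=> cA; apply: measurable_closed_cV; apply: compact_closed => //; exact: norm_hausdorff.
Qed.

Lemma convex_set_conv (R : realType) (n : nat) (K : set 'cV[R]_n) (a : R) (x y : 'cV[R]_n) :
  @convex_set R 'cV[R]_n K -> 0 <= a -> a <= 1 -> K x -> K y -> K (a *: x + (1 - a) *: y).
Proof.
move=> cK a0 a1 Kx Ky.
by have := cK x y (Itv01 a0 a1); rewrite !inE => /(_ Kx Ky).
Qed.

Lemma convex_midconvex (R : realType) (n : nat) (K : set 'cV[R]_n) :
  @convex_set R 'cV[R]_n K -> midconvex K.
Proof.
move=> cK x y Kx Ky.
have -> : 2^-1 *: (x + y) = 2^-1 *: x + (1 - 2^-1) *: y.
  by rewrite scalerDr; congr (_ + _ *: _); field.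
by apply: convex_set_conv => //; lra.
Qed.

(** * Integrals of bounded functions and means *)

(** A class stable under sums and products and integrable on sets of finite measure, so one
    predicate discharges the integrability conditions. Boundedness is asked on [K] alone because
    coordinates are unbounded on the space. *)
Definition bounded_mfun {d} {T : measurableType d} {R : realType} (K : set T) (f : T -> R) :=
  measurable_fun setT f /\ exists M, forall x, K x -> `|f x| <= M.

Section bounded_mfun.
Context d (T : measurableType d) (R : realType).
Implicit Types (K : set T) (f g : T -> R).

Lemma bounded_mfun_cst K (c : R) : bounded_mfun K (fun=> c).
Proof. by split; [exact: measurable_cst|exists `|c|]. Qed.

Lemma bounded_mfunD K f g : bounded_mfun K f -> bounded_mfun K g ->
  bounded_mfun K (fun x => f x + g x).
Proof.
move=> [mf [M fM]] [mg [N gN]]; split; first exact: measurable_funD.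
by exists (M + N) => x Kx; rewrite (le_trans (ler_normD _ _))// lerD ?fM ?gN.
Qed.

Lemma bounded_mfunM K f g : bounded_mfun K f -> bounded_mfun K g ->
  bounded_mfun K (fun x => f x * g x).
Proof.
move=> [mf [M fM]] [mg [N gN]]; split; first exact: measurable_funM.
by exists (M * N) => x Kx; rewrite normrM ler_pM ?fM ?gN.
Qed.

Lemma bounded_mfunZ K c f : bounded_mfun K f -> bounded_mfun K (fun x => c * f x).
Proof. by apply: bounded_mfunM; exact: bounded_mfun_cst. Qed.

Lemma bounded_mfunX K f n : bounded_mfun K f -> bounded_mfun K (fun x => f x ^+ n).
Proof.
move=> bf; elim: n => [|n IHn]; first exact: bounded_mfun_cst.
by under eq_fun do rewrite exprS; exact: bounded_mfunM.
Qed.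

Lemma bounded_mfunB K f g : bounded_mfun K f -> bounded_mfun K g ->
  bounded_mfun K (fun x => f x - g x).
Proof.
move=> bf bg; apply: bounded_mfunD => //.
by under eq_fun do rewrite -mulN1r; exact: bounded_mfunZ.
Qed.

Lemma bounded_mfun_sum K (I : Type) (s : seq I) (F : I -> T -> R) :
  (forall i, bounded_mfun K (F i)) -> bounded_mfun K (fun x => \sum_(i <- s) F i x).
Proof.
move=> bF; elim: s => [|i s IHs].
  by under eq_fun do rewrite big_nil; exact: bounded_mfun_cst.
by under eq_fun do rewrite big_cons; exact: bounded_mfunD.
Qed.

Context (mu : {measure set T -> \bar R}) (K : set T).
Hypotheses (mK : measurable K) (K_fin : (mu K < +oo)%E).

Lemma bounded_mfun_integrable f : bounded_mfun K f -> mu.-integrable K (EFin \o f).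
Proof.
move=> [mf [M fM]]; apply: measurable_bounded_integrable => //.
  exact: measurable_funTS.
exists M; split; first exact: num_real.
by move=> N MN x Kx /=; rewrite (le_trans (fM x Kx))// ltW.
Qed.

Lemma bounded_RintegralD f g : bounded_mfun K f -> bounded_mfun K g ->
  \int[mu]_(x in K) (f x + g x) = \int[mu]_(x in K) f x + \int[mu]_(x in K) g x.
Proof. by move=> bf bg; apply: RintegralD => //; exact: bounded_mfun_integrable. Qed.

Lemma bounded_RintegralZ c f : bounded_mfun K f ->
  \int[mu]_(x in K) (c * f x) = c * \int[mu]_(x in K) f x.
Proof. by move=> bf; apply: RintegralZl => //; exact: bounded_mfun_integrable. Qed.

Lemma bounded_Rintegral_sum (I : Type) (s : seq I) (F : I -> T -> R) :
  (forall i, bounded_mfun K (F i)) ->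
  \int[mu]_(x in K) (\sum_(i <- s) F i x) = \sum_(i <- s) \int[mu]_(x in K) F i x.
Proof.
move=> bF; elim: s => [|i s IHs].
  by under eq_Rintegral do rewrite big_nil; rewrite Rintegral_cst// mul0r big_nil.
under eq_Rintegral do rewrite big_cons.
by rewrite bounded_RintegralD ?IHs ?big_cons//; exact: bounded_mfun_sum.
Qed.

Lemma bounded_le_Rintegral f g : bounded_mfun K f -> bounded_mfun K g ->
  (forall x, K x -> f x <= g x) ->
  \int[mu]_(x in K) f x <= \int[mu]_(x in K) g x.
Proof. by move=> bf bg; apply: le_Rintegral => //; exact: bounded_mfun_integrable. Qed.

Lemma bounded_RintegralE f : bounded_mfun K f ->
  (\int[mu]_(x in K) (f x)%:E = (\int[mu]_(x in K) f x)%:E)%E.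
Proof.
by move=> bf; rewrite /Rintegral fineK// integrable_fin_num//; exact: bounded_mfun_integrable.
Qed.

End bounded_mfun.

(* The mean of a weighted random point of a midpoint-convex set [C] lies in the
   closure of [C]: integrate the almost-nearest-point inequality. *)
Lemma mean_in_closure d (T : measurableType d) (R : realType) (mu : {measure set T -> \bar R})
    (D : set T) (w : T -> R) (m : nat) (X : T -> 'cV[R]_m) (q : 'cV[R]_m) (C : set 'cV[R]_m) :
  measurable D -> (mu D < +oo)%E -> midconvex C ->
  (forall x, D x -> 0 <= w x) -> bounded_mfun D w ->
  (forall i, bounded_mfun D (fun x => w x * X x i 0)) ->
  (forall i, bounded_mfun D (fun x => w x * X x i 0 ^+ 2)) ->
  0 < \int[mu]_(x in D) w x ->
  (forall i, \int[mu]_(x in D) (w x * X x i 0) = q i 0 * \int[mu]_(x in D) w x) ->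
  (forall x, D x -> 0 < w x -> C (X x)) ->
  forall e, 0 < e -> exists2 p, C p & sqn (q - p) < e.
Proof.
move=> mD Dfin mC w0 bw bX bX2 W0 meanX CX e e0.
set W := \int[mu]_(x in D) w x in W0 meanX.
pose Q i := \int[mu]_(x in D) (w x * X x i 0 ^+ 2).
(* By [meanX], this is the integral of [w * sqn (X - q)]. *)
pose V := \sum_i (Q i - q i 0 ^+ 2 * W).
have C0 : C !=set0.
  apply: contrapT => nC; have : W <= 0.
    have <- : \int[mu]_(x in D) (0 : R) = 0 by rewrite Rintegral_cst// mul0r.
    apply: bounded_le_Rintegral => //; first exact: bounded_mfun_cst.
    move=> x Dx; rewrite leNgt; apply/negP => wx; apply: nC; exists (X x); exact: CX.
  by rewrite leNgt W0.
have VW0 : 0 < 1 + `|V| / W by rewrite ltr_wpDr// divr_ge0// ltW.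
have [k ks] : exists k : nat, 2^-1 ^+ k < e / (1 + `|V| / W).
  by apply: exp_half_small; rewrite divr_gt0.
set s := 2^-1 ^+ k in ks.
have s0 : 0 < s by rewrite exprn_gt0.
have s1 : s <= 1 by rewrite /s exprn_ile1//; lra.
have s20 : 0 < s ^+ 2 by rewrite exprn_gt0.
have [p Cp near_p] := midconvex_near_proj _ _ C q k (s ^+ 2) C0 mC s20.
exists p => //.
(* Chosen so that [q - p - s *: (X x - p) = c - s *: X x], whose square norm can be integrated term
   by term. *)
pose c := q - p + s *: p.
have sqnE x : sqn (q - p - s *: (X x - p)) =
    \sum_i (c i 0 ^+ 2 - 2 * s * c i 0 * X x i 0 + s ^+ 2 * X x i 0 ^+ 2).
  by rewrite /sqn; apply: eq_bigr => i _; rewrite /c !mxE; ring.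
have le_w x : D x -> w x * sqn (q - p) <= s ^+ 2 * w x +
    \sum_i (c i 0 ^+ 2 * w x + (- 2 * s * c i 0 * (w x * X x i 0) +
      s ^+ 2 * (w x * X x i 0 ^+ 2))).
  move=> Dx.
  have -> : s ^+ 2 * w x + \sum_i (c i 0 ^+ 2 * w x + (- 2 * s * c i 0 * (w x * X x i 0) +
      s ^+ 2 * (w x * X x i 0 ^+ 2))) = w x * (s ^+ 2 + sqn (q - p - s *: (X x - p))).
    rewrite mulrDr (mulrC (s ^+ 2)) sqnE mulr_sumr; congr (_ + _).
    by apply: eq_bigr => i _; ring.
  have := w0 x Dx; rewrite le_eqVlt => /predU1P[<-|wx]; first by rewrite !mul0r.
  by rewrite ler_pM2l//; apply: near_p; exact: CX.
have bterm i : bounded_mfun D (fun x => c i 0 ^+ 2 * w x + (- 2 * s * c i 0 * (w x * X x i 0) +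
      s ^+ 2 * (w x * X x i 0 ^+ 2))).
  by apply: bounded_mfunD; [|apply: bounded_mfunD]; exact: bounded_mfunZ.
have bsum : bounded_mfun D (fun x => \sum_i (c i 0 ^+ 2 * w x + (- 2 * s * c i 0 * (w x * X x i 0) +
      s ^+ 2 * (w x * X x i 0 ^+ 2)))) by exact: bounded_mfun_sum.
have : \int[mu]_(x in D) (sqn (q - p) * w x) <= \int[mu]_(x in D) (s ^+ 2 * w x +
    \sum_i (c i 0 ^+ 2 * w x + (- 2 * s * c i 0 * (w x * X x i 0) +
      s ^+ 2 * (w x * X x i 0 ^+ 2)))).
  apply: bounded_le_Rintegral => //; first exact: bounded_mfunZ.
    by apply: bounded_mfunD => //; exact: bounded_mfunZ.
  by move=> x Dx; rewrite mulrC; exact: le_w.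
rewrite bounded_RintegralD//; last exact: bounded_mfunZ.
rewrite !bounded_RintegralZ// bounded_Rintegral_sum//.
(* The vector is also [(1 - s) *: (q - p) - s *: (X - q)], and the cross term of its square
   integrates to zero because [q] is the mean. *)
have -> : \sum_i \int[mu]_(x in D) (c i 0 ^+ 2 * w x + (- 2 * s * c i 0 * (w x * X x i 0) +
      s ^+ 2 * (w x * X x i 0 ^+ 2))) = (1 - s) ^+ 2 * sqn (q - p) * W + s ^+ 2 * V.
  rewrite /sqn /V mulr_sumr mulr_suml mulr_sumr -big_split/=; apply: eq_bigr => i _.
  rewrite bounded_RintegralD//; last 2 first.
  - exact: bounded_mfunZ.
  - by apply: bounded_mfunD; exact: bounded_mfunZ.
  rewrite bounded_RintegralD//; last 2 first.
  - exact: bounded_mfunZ.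
  - exact: bounded_mfunZ.
  rewrite !bounded_RintegralZ// meanX -/W -/(Q i) /c !mxE; ring.
rewrite -/W; move: (sqn_ge0 _ _ (q - p)); move: (sqn (q - p)) => N N0 main.
(* What remains is [N * W * (2 * s - s ^+ 2) <= s ^+ 2 * (W + V)]. As [s <= 1], the left side is at
   least [N * W * s], and one factor [s] cancels. *)
have s21 : 0 <= s * (1 - s) by rewrite mulr_ge0 ?subr_ge0// ltW.
have h1 : N * W * s <= N * W * (2 * s - s ^+ 2).
  rewrite ler_wpM2l ?mulr_ge0 ?(ltW W0)//; lra.
have h2 : N * W * s <= s * (s * (W + V)) by lra.
have h3 : N * W <= s * (W + V) by move: h2; rewrite mulrC ler_pM2l.
have h4 : s * (W + `|V|) < e * W.
  move: ks; rewrite ltr_pdivlMr// => ks.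
  have -> : s * (W + `|V|) = s * (1 + `|V| / W) * W by field; rewrite gt_eqF.
  by rewrite ltr_pM2r.
rewrite -(ltr_pM2r W0); apply: le_lt_trans h4; apply: le_trans h3 _.
by rewrite ler_pM2l// lerD2l ler_norm.
Qed.

(** * The covariance ellipsoid *)

Lemma bounded_mfun_coord (R : realType) (n : nat) (K : set 'cV[R]_n) (i : 'I_n) :
  compact K -> bounded_mfun K (fun x => x i 0).
Proof.
move=> /compact_coord_bound[M _ KM]; split; first exact: (measurable_cV_coord i).
by exists M => x Kx; exact: KM.
Qed.

Lemma bounded_mfun_dot (R : realType) (n : nat) (K : set 'cV[R]_n) (u : 'cV[R]_n) :
  compact K -> bounded_mfun K (dot u).
Proof.
move=> cK; apply: bounded_mfun_sum => i.
by apply: bounded_mfunZ; exact: bounded_mfun_coord.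
Qed.

Lemma measurable_box (R : realType) (n : nat) (a b : 'I_n -> R) :
  measurable [set x : 'cV[R]_n | forall i, a i <= x i 0 <= b i].
Proof.
rewrite (_ : [set _ | _] = \bigcap_(i in [set: 'I_n]) (cV_coord i @^-1` `[a i, b i])).
  apply: fin_bigcap_measurable; first exact: finite_finset.
  move=> i _; rewrite -[X in measurable X]setTI.
  exact: (measurable_cV_coord i).
apply/seteqP; split => [x Bx i _|x Bx i]; first by rewrite /= in_itv/= Bx.
by have := Bx i I; rewrite /= in_itv.
Qed.

Lemma compact_vol_fin (R : realType) (n : nat) (K : set 'cV[R]_n) :
  compact K -> (lebesgue_measure_cV R n K < +oo)%E.
Proof.
move=> cK; have [M M0 KM] := compact_coord_bound _ _ _ cK.
have mK := measurable_compact_cV _ _ _ cK.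
apply: (@le_lt_trans _ _ (lebesgue_measure_cV R n
    [set x | forall i : 'I_n, (- M <= x i 0 <= M)%R])).
  apply: le_measure; rewrite ?inE//; first exact: (measurable_box _ _ (fun=> - M) (fun=> M)).
  by move=> x Kx i; rewrite -ler_norml; exact: KM.
rewrite (@lebesgue_measure_cV_box _ _ (fun=> - M) (fun=> M)) ?ltry// => _.
by rewrite ge0_cp// ltW.
Qed.

Lemma nbhs_vol_gt0 (R : realType) (n : nat) (x : 'cV[R]_n) (A : set 'cV[R]_n) :
  nbhs x A -> measurable A -> (0 < lebesgue_measure_cV R n A)%E.
Proof.
move=> /nbhs_ballP[e /= e0 eA] mA.
apply: (@lt_le_trans _ _ (lebesgue_measure_cV R n
    [set y | forall i : 'I_n, (x i 0 - e / 2 <= y i 0 <= x i 0 + e / 2)%R])).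
  rewrite (@lebesgue_measure_cV_box _ _ (fun i => x i 0 - e / 2) (fun i => x i 0 + e / 2)).
    by rewrite lte_fin prodr_gt0// => i _; lra.
  by move=> i; lra.
apply: le_measure; rewrite ?inE//.
  exact: (measurable_box _ _ (fun i => x i 0 - e / 2) (fun i => x i 0 + e / 2)).
move=> y yB; apply: eA; split => // i j; rewrite ord1 /ball/= ltr_distl.
by have /andP[] := yB i; lra.
Qed.

(** Extension by zero: the product on the left vanishes unless both points, and hence their
    midpoint, lie in [K]. *)
Lemma prekopa_leindler_on (R : realType) (n : nat) (K : set 'cV[R]_n) (f g h : 'cV[R]_n -> R) :
  measurable K -> (lebesgue_measure_cV R n K < +oo)%E -> midconvex K ->
  bounded_mfun K f -> bounded_mfun K g -> bounded_mfun K h ->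
  (forall x, K x -> 0 <= f x) -> (forall x, K x -> 0 <= g x) -> (forall x, K x -> 0 <= h x) ->
  (forall x y, K x -> K y -> f x * g y <= h (2^-1 *: (x + y)) ^+ 2) ->
  (\int[lebesgue_measure_cV R n]_(x in K) f x) * (\int[lebesgue_measure_cV R n]_(x in K) g x) <=
  (\int[lebesgue_measure_cV R n]_(x in K) h x) ^+ 2.
Proof.
move=> mK Kfin cK bf bg bh f0 g0 h0 fgh.
rewrite -lee_fin expr2 !EFinM -!bounded_RintegralE// !(integral_mkcond K).
have mext k : bounded_mfun K k -> measurable_fun setT ((fun x => (k x)%:E) \_ K).
  move=> [mk _]; apply/(measurable_restrictT _ mK).
  by apply: measurable_funTS; apply/measurable_EFinP.
have ext0 k : (forall x, K x -> 0 <= k x) -> forall x, (0 <= ((fun x => (k x)%:E) \_ K) x)%E.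
  by move=> k0 x; rewrite patchE; case: ifPn => // /[!inE] Kx; rewrite lee_fin k0.
apply: prekopa_leindler; [exact: mext|exact: mext|exact: mext|exact: ext0|exact: ext0|exact: ext0|].
move=> x y; rewrite [X in (X * _ <= _)%E]patchE [X in (_ * X <= _)%E]patchE.
case: ifPn => [/[!inE] Kx|_]; last by rewrite mul0e mule_ge0 ?ext0.
case: ifPn => [/[!inE] Ky|_]; last by rewrite mule0 mule_ge0 ?ext0.
by rewrite !patchE mem_set ?lee_fin -?expr2; [exact: fgh|exact: cK].
Qed.

(* With [H h := int_K (W + h)^2], Prekopa-Leindler gives [H 0 * H (2 h) <= (H h)^2];
   the claim is the [h^2] coefficient of this polynomial inequality. *)
Lemma second_moment_le (R : realType) (n : nat) (K : set 'cV[R]_n) (u : 'cV[R]_n) (c : R) :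
  compact K -> midconvex K -> (forall x, K x -> 0 <= c - dot u x) ->
  (\int[lebesgue_measure_cV R n]_(x in K) (c - dot u x) ^+ 2) * fine (lebesgue_measure_cV R n K) <=
  2 * (\int[lebesgue_measure_cV R n]_(x in K) (c - dot u x)) ^+ 2.
Proof.
move=> cK mcK W0.
have mK := measurable_compact_cV _ _ _ cK.
have Kfin := compact_vol_fin _ _ _ cK.
set mu := lebesgue_measure_cV R n in Kfin *.
pose W x := c - dot u x.
have bW : bounded_mfun K W by apply: bounded_mfunB; [exact: bounded_mfun_cst|exact: bounded_mfun_dot].
rewrite -/(W _); set m2 := \int[mu]_(x in K) W x ^+ 2; set m1 := \int[mu]_(x in K) W x.
set V := fine (mu K).
have V0 : 0 <= V by rewrite fine_ge0.
have m10 : 0 <= m1 by exact: Rintegral_ge0.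
pose F h x := (W x + h) ^+ 2.
have bF h : bounded_mfun K (F h).
  by apply: bounded_mfunX; apply: bounded_mfunD => //; exact: bounded_mfun_cst.
have intF h : \int[mu]_(x in K) F h x = m2 + (2 * h * m1 + h ^+ 2 * V).
  have -> : \int[mu]_(x in K) F h x = \int[mu]_(x in K) (W x ^+ 2 + (2 * h * W x + h ^+ 2)).
    by apply: eq_Rintegral => x _; rewrite /F; ring.
  have b2 : bounded_mfun K (fun x => W x ^+ 2) by exact: bounded_mfunX.
  have b1 : bounded_mfun K (fun x => 2 * h * W x) by exact: bounded_mfunZ.
  have b0 : bounded_mfun K (fun=> h ^+ 2) by exact: bounded_mfun_cst.
  rewrite bounded_RintegralD//; last exact: bounded_mfunD.
  by rewrite bounded_RintegralD// bounded_RintegralZ// Rintegral_cst.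
have main h : 0 < h -> 2 * (m2 * V) <= 4 * m1 ^+ 2 + h * (h * V ^+ 2 + 4 * m1 * V).
  move=> h0.
  have : (\int[mu]_(x in K) F 0 x) * (\int[mu]_(x in K) F (2 * h) x) <=
         (\int[mu]_(x in K) F h x) ^+ 2.
    apply: prekopa_leindler_on => //; [by move=> x _; exact: sqr_ge0..|].
    (* As [W] is affine, this is AM-GM for [W x] and [W y + 2 * h]. *)
    move=> x y Kx Ky; rewrite /F addr0 -exprMn.
    have Wx : 0 <= W x by exact: W0.
    have Wy : 0 <= W y by exact: W0.
    have -> : W (2^-1 *: (x + y)) = (W x + W y) / 2.
      by rewrite /W dotZr dotDr; field.
    move: (W x) (W y) Wx Wy => p q p0 q0.
    have pq0 : 0 <= p * (q + 2 * h) by rewrite mulr_ge0// addr_ge0// mulr_ge0// ltW.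
    rewrite ler_pXn2r ?nnegrE ?sqr_ge0//.
    by rewrite -subr_ge0 (_ : _ - _ = ((p - q) / 2 - h) ^+ 2) ?sqr_ge0//; field.
  rewrite !intF => ineq.
  have h20 : 0 < h ^+ 2 by rewrite exprn_gt0.
  rewrite -(ler_pM2l h20); lra.
rewrite leNgt; apply/negP => lt.
have V2 : 0 <= V ^+ 2 by exact: sqr_ge0.
have mV : 0 <= m1 * V by exact: mulr_ge0.
(* If the claim fails by [d > 0], then [main] gives [2 * d <= h * P] for [h <= 1], against the
   choice [h * P <= d]. *)
pose d := m2 * V - 2 * m1 ^+ 2; pose P := V ^+ 2 + 4 * m1 * V + 1.
have d0 : 0 < d by rewrite subr_gt0.
have P0 : 0 < P by rewrite /P; lra.
pose h := Num.min 1 (d / P).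
have h0 : 0 < h by rewrite lt_min ltr01 divr_gt0.
have h1 : h <= 1 by rewrite ge_min lexx.
have hd : h * P <= d by rewrite -ler_pdivlMr// ge_min lexx orbT.
have hV : h * V ^+ 2 <= V ^+ 2 by rewrite ler_piMl.
have h3 : h * (h * V ^+ 2 + 4 * m1 * V) <= h * P.
  by rewrite ler_pM2l// /P; lra.
have := main h h0; rewrite /d in d0 hd; lra.
Qed.

Lemma convex_body_midconvex (R : realType) (n : nat) (K : set 'cV[R]_n) :
  convex_body K -> midconvex K.
Proof. by move=> [cK _ _]; exact: convex_midconvex. Qed.

Lemma convex_body_compact (R : realType) (n : nat) (K : set 'cV[R]_n) :
  convex_body K -> compact K.
Proof. by move=> []. Qed.

Lemma convex_body_measurable (R : realType) (n : nat) (K : set 'cV[R]_n) :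
  convex_body K -> measurable K.
Proof. by move=> [_ cK _]; exact: measurable_compact_cV. Qed.

Lemma convex_body_vol_gt0 (R : realType) (n : nat) (K : set 'cV[R]_n) :
  convex_body K -> 0 < fine (vol K).
Proof.
move=> bK; have [_ cK [x Kx]] := bK.
rewrite fine_gt0// compact_vol_fin// andbT.
exact: (nbhs_vol_gt0 _ _ x _ Kx (convex_body_measurable _ _ _ bK)).
Qed.

Lemma convex_body_vol_fin (R : realType) (n : nat) (K : set 'cV[R]_n) :
  convex_body K -> (lebesgue_measure_cV R n K < +oo)%E.
Proof. by move=> [_ cK _]; exact: compact_vol_fin. Qed.

Section covariance.
Context (R : realType) (n : nat) (K : set 'cV[R]_n).
Hypothesis bK : convex_body K.

Let mu := lebesgue_measure_cV R n.
Let V := fine (vol K).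
Let b := barycenter K.
Let cK := convex_body_compact _ _ _ bK.
Let mK := convex_body_measurable _ _ _ bK.
Let Kfin := convex_body_vol_fin _ _ _ bK.
Let V0 := convex_body_vol_gt0 _ _ _ bK.

Lemma Rintegral_coord i : \int[mu]_(x in K) x i 0 = b i 0 * V.
Proof.
by rewrite /b /barycenter !mxE mulrC mulrA divff ?mul1r// gt_eqF.
Qed.

Lemma Rintegral_dot (u : 'cV[R]_n) : \int[mu]_(x in K) dot u x = dot u b * V.
Proof.
rewrite bounded_Rintegral_sum//; last first.
  by move=> i; apply: bounded_mfunZ; exact: bounded_mfun_coord.
rewrite /dot mulr_suml; apply: eq_bigr => i _.
by rewrite bounded_RintegralZ ?Rintegral_coord ?mulrA//; exact: bounded_mfun_coord.
Qed.

Lemma bounded_mfun_dotB (u : 'cV[R]_n) : bounded_mfun K (fun x => dot u (x - b)).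
Proof.
under eq_fun do rewrite dotBr.
by apply: bounded_mfunB; [exact: bounded_mfun_dot|exact: bounded_mfun_cst].
Qed.

Lemma Rintegral_dotB (u : 'cV[R]_n) : \int[mu]_(x in K) dot u (x - b) = 0.
Proof.
under eq_Rintegral do rewrite dotBr.
rewrite RintegralB//.
- by rewrite Rintegral_dot Rintegral_cst// subrr.
- by apply: bounded_mfun_integrable => //; exact: bounded_mfun_dot.
- by apply: bounded_mfun_integrable => //; exact: bounded_mfun_cst.
Qed.

Lemma covariance_mxE (u v : 'cV[R]_n) :
  dot u (covariance_mx K *m v) * V = \int[mu]_(x in K) (dot u (x - b) * dot v (x - b)).
Proof.
have bc i : bounded_mfun K (fun x : 'cV[R]_n => (x - b) i 0).
  under eq_fun do rewrite !mxE.
  by apply: bounded_mfunB; [exact: bounded_mfun_coord|exact: bounded_mfun_cst].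
have bcc i j : bounded_mfun K (fun x : 'cV[R]_n => (x - b) i 0 * (x - b) j 0).
  exact: bounded_mfunM.
have bt i j : bounded_mfun K (fun x : 'cV[R]_n => u i 0 * v j 0 * ((x - b) i 0 * (x - b) j 0)).
  exact: bounded_mfunZ.
transitivity (\int[mu]_(x in K) \sum_i \sum_j (u i 0 * v j 0 * ((x - b) i 0 * (x - b) j 0))).
  rewrite bounded_Rintegral_sum//; last by move=> i; exact: bounded_mfun_sum.
  rewrite /dot mulr_suml; apply: eq_bigr => i _.
  rewrite bounded_Rintegral_sum// mxE mulr_sumr mulr_suml; apply: eq_bigr => j _.
  rewrite bounded_RintegralZ// !mxE -/b -/V.
  have -> : \int[mu]_(x in K) ((x - b) *m (x - b)^T) i j =
            \int[mu]_(x in K) ((x - b) i 0 * (x - b) j 0).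
    by apply: eq_Rintegral => x _; rewrite mxE big_ord1 [X in _ * X]mxE.
  by field; rewrite gt_eqF.
apply: eq_Rintegral => x _; rewrite /dot mulr_suml; apply: eq_bigr => i _.
rewrite mulr_sumr; apply: eq_bigr => j _; ring.
Qed.

Lemma covariance_mx_ge0 (u : 'cV[R]_n) : 0 <= dot u (covariance_mx K *m u).
Proof.
rewrite -(pmulr_lge0 _ V0) covariance_mxE; apply: Rintegral_ge0 => x _.
by rewrite -expr2 sqr_ge0.
Qed.

Lemma covariance_mx_sym (u v : 'cV[R]_n) :
  dot u (covariance_mx K *m v) = dot v (covariance_mx K *m u).
Proof.
apply: (mulIf (lt0r_neq0 V0)); rewrite !covariance_mxE.
by apply: eq_Rintegral => x _; rewrite mulrC.
Qed.

(** The form [dot u (x - b)] is nonzero at some interior point of [K], hence bounded away from zero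
    on a neighbourhood of it, which has positive volume; so its square has a positive integral. *)
Lemma covariance_mx_gt0 (u : 'cV[R]_n) : u != 0 -> 0 < dot u (covariance_mx K *m u).
Proof.
move=> u0.
have su0 : 0 < sqn u.
  rewrite lt_neqAle sqn_ge0 andbT eq_sym; apply: contra u0 => /eqP su.
  apply/eqP/matrixP => i j; rewrite ord1 mxE; apply/eqP.
  by rewrite -sqrf_eq0 eq_le sqr_ge0 andbT -su le_sqn.
rewrite -(pmulr_lgt0 _ V0) covariance_mxE.
have [_ _ [x0 /nbhs_ballP[e /= e0 eK]]] := bK.
have sumu0 : 0 <= \sum_i `|u i 0| by exact: sumr_ge0.
have dot_ball x y r : ball x r y -> `|dot u (x - b) - dot u (y - b)| <= (\sum_i `|u i 0|) * r.
  move=> [_ xy]; rewrite -dotBr /dot (le_trans (ler_norm_sum _ _ _))// mulr_suml.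
  apply: ler_sum => i _; rewrite normrM ler_wpM2l// ltW//.
  by have := xy i 0; rewrite /ball/= !mxE opprB addrA subrK.
have [x1 [Kx1 x1n0]] : exists x1 : 'cV[R]_n, nbhs x1 K /\ dot u (x1 - b) != 0.
  have [x0z|] := eqVneq (dot u (x0 - b)) 0; last first.
    by move=> h; exists x0; split => //; apply/nbhs_ballP; exists e.
  (* Moving [x0] by [s *: u] leaves the hyperplane where the form vanishes, and [s] is small enough
     to keep a ball of radius [e / 2] inside [K]. *)
  pose s := e / (\sum_i `|u i 0| + 1) / 2.
  have s0 : 0 < s by rewrite !divr_gt0// ltr_wpDl.
  exists (x0 + s *: u); split; last first.
    rewrite addrAC dotDr x0z add0r dotZr dotxx mulf_neq0//; exact: lt0r_neq0.
  apply/nbhs_ballP; exists (e / 2) => [|y yb]; first by rewrite /= divr_gt0.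
  apply: eK; rewrite [e]splitr; apply: ball_triangle yb; split; first by rewrite divr_gt0.
  move=> i j; rewrite ord1 /ball/= !mxE opprD addrA subrr sub0r normrN normrM gtr0_norm//.
  rewrite /s mulrAC ltr_pM2r ?invr_gt0// mulrAC ltr_pdivrMr ?ltr_wpDl//.
  rewrite ltr_pM2l// ltr_pwDr// (bigD1 i)//= lerDl sumr_ge0//.
set v := dot u (x1 - b) in x1n0.
have v0 : 0 < `|v| by rewrite normr_gt0.
pose A := K `&` [set x | `|v| / 2 <= `|dot u (x - b)|].
have mf : measurable_fun setT (fun x : 'cV[R]_n => dot u (x - b)) by have [] := bounded_mfun_dotB u.
have mA : measurable A.
  apply: measurableI => //; rewrite -[X in measurable X]setTI.
  rewrite (_ : [set x | _] = (fun x => `|dot u (x - b)|) @^-1` `[`|v| / 2, +oo[%classic); last first.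
    by apply/seteqP; split => x /=; rewrite in_itv/= andbT.
  by apply: (measurableT_comp (@normr_measurable R setT) mf).
have nA : nbhs x1 A.
  apply: filterI => //; apply/nbhs_ballP.
  exists (`|v| / (\sum_i `|u i 0| + 1) / 2) => [|y yb]; first by rewrite /= !divr_gt0// ltr_wpDl.
  have := dot_ball _ _ _ yb; rewrite -/v => h.
  have h2 : (\sum_i `|u i 0|) * (`|v| / (\sum_i `|u i 0| + 1) / 2) <= `|v| / 2.
    rewrite mulrA ler_pM2r ?invr_gt0// mulrA ler_pdivrMr ?ltr_wpDl//.
    by rewrite mulrC ler_pM2l// lerDl.
  have h3 := ler_normB (v - dot u (y - b)) (- dot u (y - b)).
  rewrite /= ; move: h3; rewrite opprK subrK normrN => h3; lra.
have A0 := nbhs_vol_gt0 _ _ _ _ nA mA.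
have AK : A `<=` K by move=> x [].
have Afin : (mu A < +oo)%E by apply: le_lt_trans Kfin; apply: le_measure; rewrite ?inE.
have bq : bounded_mfun K (fun x => dot u (x - b) * dot u (x - b)).
  by apply: bounded_mfunM; exact: bounded_mfun_dotB.
rewrite -lte_fin -bounded_RintegralE//.
apply: (@lt_le_trans _ _ (\int[mu]_(x in A) (dot u (x - b) * dot u (x - b))%:E)%E); last first.
  apply: ge0_subset_integral => //.
    by apply/measurable_EFinP; apply: measurable_funTS; have [] := bq.
  by move=> x _; rewrite lee_fin -expr2 sqr_ge0.
apply: (@lt_le_trans _ _ (\int[mu]_(x in A) ((`|v| / 2) ^+ 2)%:E)%E).
  rewrite integral_cst// mule_gt0// lte_fin exprn_gt0// divr_gt0//.
apply: ge0_le_integral => //.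
- by apply/measurable_EFinP; apply: measurable_funTS; have [] := bq.
- move=> x [_ xA]; rewrite lee_fin -expr2 -(real_normK (num_real (dot _ _))).
  by rewrite ler_pXn2r// nnegrE divr_ge0.
Qed.

Lemma covariance_mx_unit : covariance_mx K \in unitmx.
Proof.
rewrite unitmxE unitfE; apply/negP => /det0P[v v0 vC].
have : v^T != 0 by apply: contra v0 => /eqP vT; rewrite -(trmxK v) vT trmx0.
move=> /covariance_mx_gt0; rewrite ltNge => /negP; apply.
have -> : dot v^T (covariance_mx K *m v^T) = (v *m covariance_mx K *m v^T) 0 0.
  by rewrite -mulmxA mxE; apply: eq_bigr => i _; rewrite mxE.
by rewrite vC mul0mx mxE.
Qed.

(** Cauchy-Schwarz for the positive form of the covariance matrix, between [u] and [w], the preimage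
    of [e], at which the form is at most 1. *)
Lemma covariance_ellipsoid_dot (u e : 'cV[R]_n) :
  covariance_ellipsoid K e -> dot u e ^+ 2 <= dot u (covariance_mx K *m u).
Proof.
rewrite /covariance_ellipsoid/=.
pose w := invmx (covariance_mx K) *m e.
have Cw : covariance_mx K *m w = e by rewrite mulmxA mulmxV ?mul1mx// covariance_mx_unit.
have -> : (e^T *m invmx (covariance_mx K) *m e) 0 0 = dot w (covariance_mx K *m w).
  by rewrite Cw -mulmxA -/w mxE; apply: eq_bigr => i _; rewrite mxE mulrC.
move=> w1; rewrite -[in leLHS]Cw; set B := dot u (covariance_mx K *m w).
(* Writing [Q] for the form, this reads [Q u - 2 * B ^+ 2 + B ^+ 2 * Q w >= 0], where [Q w <= 1]. *)
have := covariance_mx_ge0 (u - B *: w).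
rewrite mulmxBr -scalemxAr !(dotBl, dotBr, dotZl, dotZr) (covariance_mx_sym w u) -/B => h.
have := sqr_ge0 B; nra.
Qed.

Lemma barycenterB_ellipsoid (e : 'cV[R]_n) : covariance_ellipsoid K e -> K (b - e).
Proof.
move=> eE; apply: contrapT => nKy.
have K0 : K !=set0.
  by have [_ _ [x /nbhs_singleton Kx]] := bK; exists x.
have [u [d d0 sep]] := compact_separation _ _ _ _ K0 (convex_body_midconvex _ _ _ bK) cK nKy.
pose c := dot u (b - e) - d.
have W0 x : K x -> 0 <= c - dot u x by move=> /sep; rewrite /c; lra.
have := second_moment_le _ _ _ _ _ cK (convex_body_midconvex _ _ _ bK) W0.
pose m1 := c - dot u b.
have muV : fine (mu K) = V by [].
have bd := bounded_mfun_dot _ _ _ u cK.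
have bdb := bounded_mfun_dotB u.
have int1 : \int[mu]_(x in K) (c - dot u x) = m1 * V.
  rewrite RintegralB//; last 2 first.
  - by apply: bounded_mfun_integrable => //; exact: bounded_mfun_cst.
  - exact: bounded_mfun_integrable.
  by rewrite Rintegral_cst// Rintegral_dot muV /m1; ring.
have int2 : \int[mu]_(x in K) (c - dot u x) ^+ 2 = (m1 ^+ 2 + dot u (covariance_mx K *m u)) * V.
  have -> : \int[mu]_(x in K) (c - dot u x) ^+ 2 =
    \int[mu]_(x in K) (m1 ^+ 2 + (- (2 * m1) * dot u (x - b) + dot u (x - b) * dot u (x - b))).
    by apply: eq_Rintegral => x _; rewrite /m1 dotBr; ring.
  have b1 : bounded_mfun K (fun x => - (2 * m1) * dot u (x - b)) by exact: bounded_mfunZ.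
  have b2 : bounded_mfun K (fun x => dot u (x - b) * dot u (x - b)) by exact: bounded_mfunM.
  have b0 : bounded_mfun K (fun=> m1 ^+ 2) by exact: bounded_mfun_cst.
  rewrite bounded_RintegralD//; last exact: bounded_mfunD.
  rewrite Rintegral_cst// bounded_RintegralD// bounded_RintegralZ//.
  rewrite Rintegral_dotB.
  by rewrite -covariance_mxE muV; ring.
have m10 : 0 <= m1.
  by rewrite -(pmulr_lge0 _ V0) -int1; apply: Rintegral_ge0.
rewrite -/mu -/V int1 int2 => ineq.
have le1 : dot u (covariance_mx K *m u) <= m1 ^+ 2.
  have V2 : 0 < V * V by rewrite mulr_gt0.
  rewrite -(ler_pM2r V2); lra.
have := covariance_ellipsoid_dot u e eE => /le_trans/(_ le1).
rewrite -(real_normK (num_real (dot u e))) ler_pXn2r ?nnegrE// => le2.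
have := lerN2 (dot u e) (- `|dot u e|); have := lerNnormlW (lexx `|dot u e|).
(* With [d > 0] this contradicts the bound of [|dot u e|] by [m1]. *)
have : m1 = - dot u e - d by rewrite /m1 /c dotBr; ring.
lra.
Qed.

End covariance.

(** * The Milman-Pajor inequality *)

Definition reflection_cap {R : realType} {n : nat} (K : set 'cV[R]_n) (m : 'cV[R]_n) : set 'cV[R]_n :=
  [set x | K x /\ K (2 *: m - x)].

(** As a function of [2 *: m], this is the convolution of the indicator of [K] with itself. *)
Definition reflection_vol {R : realType} {n : nat} (K : set 'cV[R]_n) (m : 'cV[R]_n) : R :=
  fine (vol (reflection_cap K m)).

(** The left side is the tangent line at [a] of the convex function [u * ln u]. *)
Lemma xlnx_ge (R : realType) (a u : R) : 0 < a -> 0 <= u -> u * ln a + u - a <= u * ln u.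
Proof.
move=> a0; rewrite le_eqVlt => /predU1P[<-|u0]; first by rewrite !mul0r; lra.
have := @expR_ge1Dx R (ln (a / u)); rewrite lnK ?posrE ?divr_gt0// ln_div ?posrE// => h.
have : u * (1 + (ln a - ln u)) <= u * (a / u) by rewrite ler_pM2l.
by rewrite mulrC [X in _ <= X]mulrC divfK ?gt_eqF//; lra.
Qed.

(** Makes [F * ln F ^+ 2] bounded although [ln F] is not. For [u < 1] and [t = - ln u / 2] the left
    side is [4 * (t * expR (- t)) ^+ 2], at most 4; for [u >= 1] it is monotone. *)
Lemma xln2x_le (R : realType) (v u : R) : 0 <= u -> u <= v -> u * ln u ^+ 2 <= 4 + v * ln v ^+ 2.
Proof.
rewrite le_eqVlt => /predU1P[<- v0|u0 uv]; first by rewrite mul0r addr_ge0// mulr_ge0// sqr_ge0.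
have v0 : 0 < v by exact: lt_le_trans uv.
have [u1|u1] := leP 1 u.
  apply: (@le_trans _ _ (v * ln v ^+ 2)); last by rewrite lerDr.
  rewrite ler_pM ?sqr_ge0 ?(ltW u0)//.
  by rewrite ler_pXn2r ?nnegrE ?ln_ge0 ?(le_trans u1 uv)// ler_ln ?posrE.
apply: (@le_trans _ _ 4); last by rewrite lerDl mulr_ge0 ?sqr_ge0// ltW.
pose t := - ln u / 2.
have t0 : 0 <= t by rewrite divr_ge0// oppr_ge0 ltW// ln_lt0// u0.
have lnu : ln u = - t - t by rewrite /t; field.
have uE : u = expR (- t) * expR (- t) by rewrite -expRD -lnu lnK.
have te : t * expR (- t) <= 1.
  rewrite expRN ler_pdivrMr ?expR_gt0// mul1r.
  by have := expR_ge1Dx t; lra.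
have -> : u * ln u ^+ 2 = 4 * (t * expR (- t)) ^+ 2 by rewrite lnu [X in X * _]uE; ring.
by rewrite -[leRHS]mulr1 ler_pM2l// exprn_ile1// mulr_ge0// expR_ge0.
Qed.

Section reflection_vol.
Context (R : realType) (n : nat) (K : set 'cV[R]_n).
Hypothesis bK : convex_body K.

Let mu := lebesgue_measure_cV R n.
Let V := fine (vol K).
Let b := barycenter K.
Let F := reflection_vol K.
Let cK := convex_body_compact _ _ _ bK.
Let mK := convex_body_measurable _ _ _ bK.
Let Kfin := convex_body_vol_fin _ _ _ bK.
Let V0 := convex_body_vol_gt0 _ _ _ bK.
Let mcK := convex_body_midconvex _ _ _ bK.

(** The caps are the sections of [S], whose measurability yields that of each cap and of [F]. *)
Let S : set ('cV[R]_n * 'cV[R]_n) := [set p | K p.2 /\ K (2 *: p.1 - p.2)].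

Let mS : measurable S.
Proof.
apply: measurableI.
  rewrite -[X in measurable X]setTI; exact: measurable_snd.
rewrite -[X in measurable X]setTI.
suff : measurable_fun setT (fun p : 'cV[R]_n * 'cV[R]_n => 2 *: p.1 - p.2) by exact.
apply: measurable_fun_cV => i.
rewrite (_ : _ \o _ = (fun p => 2 * cV_coord i p.1 - cV_coord i p.2)); last first.
  by apply/funext => p; rewrite /cV_coord/= !mxE.
apply: measurable_funB.
  apply: measurable_funM => //.
  by apply: measurableT_comp; [exact: measurable_cV_coord|exact: measurable_fst].
by apply: measurableT_comp; [exact: measurable_cV_coord|exact: measurable_snd].
Qed.

Let xsectionS m : xsection S m = reflection_cap K m.
Proof. by apply/seteqP; split => x; rewrite /xsection/= inE. Qed.

Lemma measurable_reflection_cap m : measurable (reflection_cap K m).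
Proof. by rewrite -xsectionS; exact: measurable_xsection. Qed.

Lemma reflection_cap_fin m : mu (reflection_cap K m) \is a fin_num.
Proof.
rewrite ge0_fin_numE//; apply: le_lt_trans Kfin; apply: le_measure; rewrite ?inE//.
  exact: measurable_reflection_cap.
by move=> x [].
Qed.

Lemma reflection_volE m : (F m)%:E = mu (reflection_cap K m).
Proof. by rewrite /F /reflection_vol fineK//; exact: reflection_cap_fin. Qed.

Lemma reflection_vol_ge0 m : 0 <= F m.
Proof. exact: fine_ge0. Qed.

Lemma reflection_vol_le m : F m <= V.
Proof.
rewrite /F /V fine_le ?reflection_cap_fin//; first by rewrite ge0_fin_numE.
apply: le_measure; rewrite ?inE//; first exact: measurable_reflection_cap.
by move=> x [].
Qed.

Lemma bounded_reflection_vol : bounded_mfun K F.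
Proof.
split; last by exists V => x _; rewrite ger0_norm ?reflection_vol_ge0// reflection_vol_le.
apply/measurable_EFinP.
rewrite (_ : _ \o _ = mu \o xsection S); first exact: measurable_fun_xsection.
by apply/funext => m /=; rewrite xsectionS; exact: reflection_volE.
Qed.

(** Prekopa-Leindler for indicators: midpoints between the caps at [x] and [y] fall in the cap at
    the midpoint. *)
Lemma reflection_vol_log_midconcave x y : F x * F y <= F (2^-1 *: (x + y)) ^+ 2.
Proof.
rewrite -lee_fin expr2 !EFinM !reflection_volE.
have m := measurable_reflection_cap.
rewrite -[X in (mu X * _ <= _)%E]setIT -[X in (_ * mu X <= _)%E]setIT.
rewrite -[X in (_ <= mu X * mu X)%E]setIT -!integral_indic//.
have mi z : measurable_fun setT (fun t => (\1_(reflection_cap K z) t)%:E : \bar R).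
  by apply/measurable_EFinP; exact: measurable_indic.
apply: prekopa_leindler => //.
move=> s t; rewrite -!EFinM lee_fin !indicE.
have [/[!inE] -[Ks Ks']|_] := boolP (s \in _); last by rewrite mul0r mulr_ge0.
have [/[!inE] -[Kt Kt']|_] := boolP (t \in _); last by rewrite mulr0 mulr_ge0.
rewrite mem_set//; split; first exact: mcK.
have := mcK _ _ Ks' Kt'; congr K.
by apply/matrixP => i j; rewrite !mxE; field.
Qed.

(** Upper semicontinuity, stated in the form that [mean_in_closure] feeds. A point in infinitely
    many caps whose centres tend to [q] lies in the cap at [q], as [K] is closed; continuity from
    above bounds the volume of this limsup by [c] from below. *)
Lemma reflection_vol_usc (q : 'cV[R]_n) (c : R) :
  (forall e, 0 < e -> exists2 m : 'cV[R]_n, sqn (q - m) < e & c <= F m) -> c <= F q.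
Proof.
move=> H.
have /choice[m mP] : forall k : nat, exists m : 'cV[R]_n, sqn (q - m) < 2^-1 ^+ k /\ c <= F m.
  by move=> k; have [|m ? ?] := H (2^-1 ^+ k); [rewrite exprn_gt0|exists m].
pose E j : set 'cV[R]_n := \bigcup_(k in [set k | (j <= k)%N]) reflection_cap K (m k).
have mE j : measurable (E j).
  by apply: bigcup_measurable => k _; exact: measurable_reflection_cap.
have EK j : E j `<=` K by move=> x [k _ []].
have mEE : measurable (\bigcap_j E j) by apply: bigcap_measurable => //; exists 0%N.
have E0fin : (mu (E 0%N) < +oo)%E.
  by apply: le_lt_trans Kfin; apply: le_measure; rewrite ?inE.
have Edec : {homo E : i j / (i <= j)%N >-> (j <= i)%O}.
  move=> i j ij; apply/subsetPset => x [k /= jk Ax]; exists k => //=.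
  exact: leq_trans jk.
have cv := @nonincreasing_cvg_mu _ _ _ mu E E0fin mE mEE Edec.
have : (c%:E <= mu (\bigcap_j E j))%E.
  apply: (cvge_ge _ cv); apply: nearW => j /=.
  apply: (@le_trans _ _ (mu (reflection_cap K (m j)))).
    by rewrite -reflection_volE lee_fin; have [] := mP j.
  apply: le_measure; rewrite ?inE//; first exact: measurable_reflection_cap.
  by move=> x Ax; exists j => //=.
rewrite -lee_fin reflection_volE => /le_trans; apply.
apply: le_measure; rewrite ?inE//; first exact: measurable_reflection_cap.
move=> x Ex; split; first by apply: (EK 0%N); exact: Ex.
apply: contrapT => nK.
have [d d0 dK] := closed_sqn_dist _ _ _ _ (compact_closed (@norm_hausdorff _ _) cK) nK.
(* Reflection doubles the displacement of the centre, so square distances grow by 4. *)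
have [j jd] : exists j : nat, 2^-1 ^+ j < d / 4 by apply: exp_half_small; rewrite divr_gt0.
have [k /= jk [_ Kk]] := Ex j I.
have := dK _ Kk.
have -> : 2 *: q - x - (2 *: m k - x) = 0 - (- 2) *: (q - m k).
  by apply/matrixP => i l; rewrite !mxE; ring.
rewrite sqnBZ -dotxx !dot0l mulr0 subrr add0r => h.
have [h2 _] := mP k.
have h3 : 2^-1 ^+ k <= 2^-1 ^+ j :> R by rewrite ler_wiXn2l//; lra.
suff : d < d by rewrite ltxx.
apply: (le_lt_trans h); rewrite sqrrN -natrX mulrC -ltr_pdivlMr//.
exact: lt_trans h2 (le_lt_trans h3 jd).
Qed.

(** The left side integrates [dot u m + c] over the pairs [(m, y)] of [S]. At fixed [y],
    substituting [m = (z + y) / 2] costs [2^-n] and lets [z] and [y] range independently over [K],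
    where the affine form averages to its value at [b]. Nonnegativity gives access to Tonelli. *)
Lemma Rintegral_affine_reflection_vol (u : 'cV[R]_n) (c : R) :
  (forall x, K x -> 0 <= dot u x + c) ->
  \int[mu]_(x in K) ((dot u x + c) * F x) = 2^-1 ^+ n * (dot u b + c) * V ^+ 2.
Proof.
move=> phi0.
have bphi : bounded_mfun K (fun x => dot u x + c).
  by apply: bounded_mfunD; [exact: bounded_mfun_dot|exact: bounded_mfun_cst].
have bd := bounded_mfun_dot _ _ _ u cK.
apply: EFin_inj; rewrite -bounded_RintegralE//; last first.
  by apply: bounded_mfunM => //; exact: bounded_reflection_vol.
(* Cut off to be nonnegative everywhere; nothing is lost, since midpoints of points of [K] stay in
   [K]. *)
pose phiK (x : 'cV[R]_n) : R := (dot u x + c) * \1_K x.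
have phiK0 x : 0 <= phiK x.
  by rewrite /phiK indicE; have [/[!inE] /phi0|_] := boolP (x \in K); rewrite ?mulr1 ?mulr0.
have mphiK : measurable_fun setT phiK.
  by apply: measurable_funM; [have [] := bphi|exact: measurable_indic].
pose G (p : 'cV[R]_n * 'cV[R]_n) : \bar R := (phiK p.1 * \1_S p)%:E.
have mG : measurable_fun setT G.
  apply/measurable_EFinP; apply: measurable_funM; last exact: measurable_indic.
  by apply: measurableT_comp => //; exact: measurable_fst.
have G0 p : (0 <= G p)%E by rewrite lee_fin mulr_ge0.
transitivity (\int[mu]_x \int[mu]_y G (x, y))%E.
  rewrite integral_mkcond; apply: eq_integral => x _.
  rewrite /G/=.
  transitivity ((phiK x)%:E * \int[mu]_y (\1_(reflection_cap K x) y)%:E)%E; last first.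
    rewrite -ge0_integralZl_EFin//.
      by apply/measurable_EFinP; apply: measurable_indic; exact: measurable_reflection_cap.
  rewrite integral_indic ?setIT//; last exact: measurable_reflection_cap.
  rewrite -[X in (_ * X)%E](reflection_volE x) -EFinM patchE /phiK indicE.
  by case: ifPn => _; rewrite ?mulr1// mulr0 mul0r.
rewrite (fubini_tonelli G)//.
transitivity (\int[mu]_(y in K) ((2^-1 ^+ n * ((2^-1 * dot u y + c) * V + 2^-1 * (dot u b * V)))%:E))%E.
  rewrite [RHS]integral_mkcond; apply: eq_integral => y _.
  rewrite (ge0_integral_cV_affine _ _ 2^-1 (2^-1 *: y))//; last first.
    exact: measurable_fun_pair1.
  rewrite patchE; case: ifPn => [/[!inE] Ky|nKy]; last first.
    rewrite (eq_integral (fun=> 0%E)) ?integral0 ?mule0// => z _.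
    by rewrite /G/= indicE memNset ?mulr0// => -[/= Ky _]; move/negP: nKy; rewrite inE.
  rewrite [RHS]EFinM; congr (_ * _)%E.
  have bin : bounded_mfun K (fun z => (2^-1 * dot u y + c) + 2^-1 * dot u z).
    by apply: bounded_mfunD; [exact: bounded_mfun_cst|exact: bounded_mfunZ].
  transitivity (\int[mu]_(z in K) (((2^-1 * dot u y + c) + 2^-1 * dot u z)%:E))%E.
    rewrite [RHS]integral_mkcond; apply: eq_integral => z _.
    have zE : 2 *: (2^-1 *: z + 2^-1 *: y) - y = z.
      by apply/matrixP => i j; rewrite !mxE; field.
    rewrite patchE /G/= /phiK indicE [X in _ * X]indicE.
    case: ifPn => [/[!inE] Kz|nKz].
      rewrite mem_set; last by rewrite -scalerDr; exact: mcK.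
      rewrite mem_set; last by split => //=; rewrite zE.
      by rewrite !mulr1 dotDr !dotZr; congr EFin; ring.
    rewrite [X in _ * (nat_of_bool X)%:R]memNset ?mulr0//.
    by rewrite /S/= zE => -[_ Kz]; move/negP: nKz; rewrite inE.
  rewrite bounded_RintegralE// bounded_RintegralD//; last 2 first.
  - exact: bounded_mfun_cst.
  - exact: bounded_mfunZ.
  by rewrite Rintegral_cst// bounded_RintegralZ// (Rintegral_dot _ _ _ bK).
have bout : bounded_mfun K (fun y => 2^-1 ^+ n * ((2^-1 * dot u y + c) * V + 2^-1 * (dot u b * V))).
  apply: bounded_mfunZ; apply: bounded_mfunD; last exact: bounded_mfun_cst.
  apply: bounded_mfunM; last exact: bounded_mfun_cst.
  by apply: bounded_mfunD; [exact: bounded_mfunZ|exact: bounded_mfun_cst].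
rewrite bounded_RintegralE//; congr EFin.
have -> : \int[mu]_(y in K) (2^-1 ^+ n * ((2^-1 * dot u y + c) * V + 2^-1 * (dot u b * V))) =
  \int[mu]_(y in K) (2^-1 ^+ n * 2^-1 * V * dot u y + 2^-1 ^+ n * (c * V + 2^-1 * (dot u b * V))).
  by apply: eq_Rintegral => y _; ring.
rewrite bounded_RintegralD//; last 2 first.
- exact: bounded_mfunZ.
- exact: bounded_mfun_cst.
rewrite Rintegral_cst// bounded_RintegralZ// (Rintegral_dot _ _ _ bK) -/mu -/b.
have -> : fine (mu K) = V by [].
by rewrite -/V; field.
Qed.

Lemma Rintegral_reflection_vol : \int[mu]_(x in K) F x = 2^-1 ^+ n * V ^+ 2.
Proof.
have := Rintegral_affine_reflection_vol 0 1; rewrite dot0l add0r mulr1 => <-.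
  by apply: eq_Rintegral => x _; rewrite dot0l add0r mul1r.
by move=> x _; rewrite dot0l add0r.
Qed.

Lemma Rintegral_coord_reflection_vol i :
  \int[mu]_(x in K) (F x * x i 0) = b i 0 * \int[mu]_(x in K) F x.
Proof.
have dotd z : dot (delta_mx i 0 : 'cV[R]_n) z = z i 0.
  rewrite /dot (bigD1 i)//= big1 ?addr0 ?mxE ?eqxx ?mul1r// => j ji.
  by rewrite mxE (negbTE ji) mul0r.
have [M M0 KM] := compact_coord_bound _ _ _ cK.
have bF := bounded_reflection_vol.
have bc := bounded_mfun_coord _ _ _ i cK.
(* Adding the bound [M] makes the coordinate nonnegative on [K]; its share is subtracted afterwards
   through the integral of [F]. *)
have := Rintegral_affine_reflection_vol (delta_mx i 0) M.
have -> : \int[mu]_(x in K) ((dot (delta_mx i 0) x + M) * F x) =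
          \int[mu]_(x in K) (F x * x i 0 + M * F x).
  by apply: eq_Rintegral => x _; rewrite dotd; ring.
rewrite bounded_RintegralD//; last 2 first.
- exact: bounded_mfunM.
- exact: bounded_mfunZ.
rewrite bounded_RintegralZ// Rintegral_reflection_vol dotd => h.
suff : \int[mu]_(x in K) (F x * x i 0) + M * (2^-1 ^+ n * V ^+ 2) =
  2^-1 ^+ n * (b i 0 + M) * V ^+ 2 by lra.
apply: h => x Kx; rewrite dotd.
by have := KM x i Kx; rewrite ler_norml; lra.
Qed.

(* Jensen's inequality for the concave function [ln F] and the weight [F], in the form of
   [mean_in_closure] for the hypograph of [ln F], which is closed by semicontinuity. *)
Lemma reflection_vol_barycenter : 2^-1 ^+ n * V <= F b.
Proof.
have bF := bounded_reflection_vol.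
have F0 := reflection_vol_ge0.
pose W := \int[mu]_(x in K) F x.
pose A := 2^-1 ^+ n * V.
have A0 : 0 < A by rewrite mulr_gt0// exprn_gt0.
have WA : W = A * V by rewrite /W Rintegral_reflection_vol /A; ring.
have W0 : 0 < W by rewrite WA mulr_gt0.
have mlnF : measurable_fun setT (fun x => ln (F x)).
  by apply: measurableT_comp; [exact: measurable_ln|have [] := bF].
(* Where [F] vanishes, [ln] takes the default value 0, and the weight [F] discards such points. *)
have bl2 : bounded_mfun K (fun x => F x * ln (F x) ^+ 2).
  split; first by apply: measurable_funM; [have [] := bF|exact: measurable_funX].
  exists (4 + V * ln V ^+ 2) => x _; rewrite ger0_norm; last by rewrite mulr_ge0// sqr_ge0.
  by apply: xln2x_le => //; exact: reflection_vol_le.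
have bl : bounded_mfun K (fun x => F x * ln (F x)).
  split; first by apply: measurable_funM; [have [] := bF|].
  exists (V + (4 + V * ln V ^+ 2)) => x _.
  apply: (@le_trans _ _ (F x + F x * ln (F x) ^+ 2)); last first.
    by apply: lerD; [exact: reflection_vol_le|apply: xln2x_le => //; exact: reflection_vol_le].
  rewrite normrM ger0_norm// -[X in X + _]mulr1 -mulrDr ler_wpM2l//.
  have := sqr_ge0 (1 - `|ln (F x)|); rewrite -(real_normK (num_real (ln (F x)))); nra.
pose r := (\int[mu]_(x in K) (F x * ln (F x))) / W.
(* The tangent line of [u * ln u] is taken at [A], the mean of [F] on [K], so that its term [F - A]
   integrates to zero. *)
have lnAr : ln A <= r.
  rewrite /r ler_pdivlMr//.
  have : \int[mu]_(x in K) (F x * ln A + F x - A) <= \int[mu]_(x in K) (F x * ln (F x)).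
    apply: bounded_le_Rintegral => //.
      by apply: bounded_mfunB; [apply: bounded_mfunD => //; apply: bounded_mfunM => //|];
        exact: bounded_mfun_cst.
    by move=> x _; exact: xlnx_ge.
  have -> : \int[mu]_(x in K) (F x * ln A + F x - A) = \int[mu]_(x in K) ((ln A + 1) * F x + - A).
    by apply: eq_Rintegral => x _; ring.
  rewrite bounded_RintegralD//; [|exact: bounded_mfunZ|exact: bounded_mfun_cst].
  rewrite bounded_RintegralZ// Rintegral_cst// -/W.
  have -> : fine (mu K) = V by [].
  by rewrite WA; lra.
(* Written with [expR], the hypograph is empty over the zeros of [F]; with [ln 0 = 0] it would gain
   spurious points there. *)
pose C : set 'cV[R]_(n + 1) := [set z : 'cV[R]_(n + 1) | expR (z (rshift n 0) 0) <= F (usubmx z)].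
pose X (x : 'cV[R]_n) : 'cV[R]_(n + 1) := col_mx x (ln (F x))%:M.
pose q : 'cV[R]_(n + 1) := col_mx b r%:M.
have Xl x i : X x (lshift 1 i) 0 = x i 0 by rewrite /X col_mxEu.
have Xr x i : X x (rshift n i) 0 = ln (F x) by rewrite /X col_mxEd !ord1 mxE eqxx mulr1n.
have ql i : q (lshift 1 i) 0 = b i 0 by rewrite /q col_mxEu.
have qr : q (rshift n 0) 0 = r by rewrite /q col_mxEd mxE eqxx mulr1n.
have mC : midconvex C.
  move=> x y; rewrite /C/= !mxE => Cx Cy.
  have -> : usubmx (2^-1 *: (x + y)) = 2^-1 *: (usubmx x + usubmx y) by apply/matrixP => i j; rewrite !mxE.
  rewrite -(ler_pXn2r (n := 2))// ?nnegrE ?expR_ge0//.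
  apply: le_trans (reflection_vol_log_midconcave _ _).
  rewrite expr2 -expRD.
  have -> : 2^-1 * (x (rshift n 0) 0 + y (rshift n 0) 0) + 2^-1 * (x (rshift n 0) 0 + y (rshift n 0) 0) =
     x (rshift n 0) 0 + y (rshift n 0) 0 by field.
  by rewrite expRD ler_pM ?expR_ge0.
have near_q : forall e, 0 < e -> exists2 p, C p & sqn (q - p) < e.
  apply: (@mean_in_closure _ _ _ mu K F _ X q C) => //.
  - move=> i; case: (split_ordP i) => j ->.
      by under eq_fun do rewrite Xl; apply: bounded_mfunM => //; exact: bounded_mfun_coord.
    by under eq_fun do rewrite Xr.
  - move=> i; case: (split_ordP i) => j ->.
      by under eq_fun do rewrite Xl; apply: bounded_mfunM => //; apply: bounded_mfunX; exact: bounded_mfun_coord.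
    by under eq_fun do rewrite Xr.
  - move=> i; case: (split_ordP i) => j ->.
      under eq_Rintegral do rewrite Xl.
      by rewrite Rintegral_coord_reflection_vol ql.
    under eq_Rintegral do rewrite Xr.
    by rewrite ord1 qr /r divfK// gt_eqF.
  - by move=> x Kx Fx; rewrite /C/= Xr /X col_mxKu lnK.
rewrite -/A leNgt; apply/negP => FA.
(* If [F b < A], then [F b < c < A] and [ln c < ln A <= r]. Points of [C] close enough to [q] have
   height above [ln c], so [F >= c] arbitrarily near [b], and semicontinuity forces [c <= F b]. *)
pose c := (F b + A) / 2.
have c0 : 0 < c by rewrite divr_gt0// ltr_wpDl.
have FC : F b < c by rewrite /c; lra.
have cA : c < A by rewrite /c; lra.
move: FC; apply/negP; rewrite -leNgt; apply: reflection_vol_usc => e e0.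
pose eta := r - ln c.
have eta0 : 0 < eta by rewrite subr_gt0; apply: lt_le_trans lnAr; rewrite ltr_ln ?posrE.
have [|p Cp pq] := near_q (Num.min e (eta ^+ 2)); first by rewrite lt_min e0 exprn_gt0.
move: pq; rewrite lt_min => /andP[pe peta].
exists (usubmx p).
  apply: le_lt_trans pe; rewrite /sqn big_split_ord/=.
  rewrite -[leLHS]addr0 lerD//; last by apply: sumr_ge0 => i _; exact: sqr_ge0.
  apply: ler_sum => i _.
  by have -> : (b - usubmx p) i 0 = (q - p) (lshift 1 i) 0 by rewrite [RHS]mxE ql !mxE.
apply: le_trans Cp; rewrite -[leLHS]lnK ?posrE// ler_expR.
have := le_lt_trans (le_sqn _ _ (q - p) (rshift n 0)) peta.
have -> : (q - p) (rshift n 0) 0 = r - p (rshift n 0) 0 by rewrite mxE qr mxE.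
rewrite -(real_normK (num_real (r - _))).
rewrite ltr_pXn2r// ?nnegrE ?(ltW eta0)// => h.
by have := ler_norm (r - p (rshift n 0) 0); rewrite /eta in h; lra.
Qed.

End reflection_vol.

(** * Contraction of the cap at the barycenter into [K] and its reflection *)

Theorem theoremA1 (R : realType) (n : nat) (K : set 'cV[R]_n) (t : R) :
  convex_body K ->
  0 <= t < 1 ->
  [set t *: x | x in covariance_ellipsoid K] (barycenter K) ->
  ((((1 - t) / 2) ^+ n)%:E * vol K <= vol (K `&` [set (- x)%R | x in K]))%E.
Proof.
move=> bK /andP[t0 t1] [e eE eb].
have mK := convex_body_measurable _ _ _ bK.
have Ky := barycenterB_ellipsoid _ _ _ bK e eE.
set y := barycenter K - e in Ky.
have KNK : K `&` [set (- x)%R | x in K] = K `&` (fun x => (-1) *: x + 0) @^-1` K.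
  apply/seteqP; split => x [Kx].
    by move=> [z Kz zx]; split => //=; rewrite -zx scaleN1r opprK addr0.
  by rewrite /= scaleN1r addr0 => KNx; split => //; exists (- x) => //; rewrite opprK.
have mKNK : measurable (K `&` [set (- x)%R | x in K]).
  rewrite KNK; apply: measurableI => //.
  by rewrite -[X in measurable X]setTI; apply: measurable_cV_affine.
have s0 : 0 < 1 - t by rewrite subr_gt0.
rewrite /vol [leRHS](lebesgue_measure_cV_affine _ _ (1 - t) (t *: y))//.
have -> : ((1 - t) / 2) ^+ n = (1 - t) ^+ n * 2^-1 ^+ n by rewrite exprMn.
rewrite EFinM -muleA; apply: lee_wpmul2l; first by rewrite lee_fin exprn_ge0// ltW.
apply: (@le_trans _ _ (lebesgue_measure_cV R n (reflection_cap K (barycenter K)))).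
  have Vfin : lebesgue_measure_cV R n K \is a fin_num.
    by rewrite ge0_fin_numE// convex_body_vol_fin.
  rewrite -(fineK Vfin) -EFinM -(reflection_volE _ _ _ bK) lee_fin.
  exact: reflection_vol_barycenter.
apply: le_measure; rewrite ?inE.
- exact: measurable_reflection_cap.
- by rewrite -[X in measurable X]setTI; apply: measurable_cV_affine.
move=> x [Kx Kx']; have [cK _ _] := bK.
have conv z : K z -> K ((1 - t) *: z + t *: y).
  move=> Kz; have -> : (1 - t) *: z + t *: y = (1 - t) *: z + (1 - (1 - t)) *: y.
    by congr (_ + _ *: _); ring.
  by apply: convex_set_conv => //; lra.
split; first exact: conv.
(* The contraction sends [b] to 0, so it carries the reflection about [b] to the one about 0: the
   image of [2 b - x] is minus the image of [x]. *)
exists ((1 - t) *: (2 *: barycenter K - x) + t *: y); first exact: conv.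
have -> : t *: y = - ((1 - t) *: barycenter K).
  by rewrite /y scalerBr eb scalerBl scale1r opprB.
by apply/matrixP => i j; rewrite !mxE; ring.
Qed.
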